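(* Let $[a,b]\subseteq(0,2]$ and let $\alpha:\mathbb{R}\to[a,b]$ be continuous with $|\alpha(x+r)-\alpha(x)|=o(1/\log r)$ as $r\to0$, uniformly on bounded intervals, i.e. for every bounded interval $J$, $\sup_{x\in J}|\alpha(x+r)-\alpha(x)|\,|\log r|\to0$ as $r\downarrow0$. Let $u\in\mathbb{R}$. Then for all functions $f_1,\dots,f_d\in\mathcal{F}_{a,b}$ with compact support, $$\Big(r^{-1/\alpha(u)}\int f_1(x)\,d(T_{u,r}^{\#}M_\alpha)(x),\dots,r^{-1/\alpha(u)}\int f_d(x)\,d(T_{u,r}^{\#}M_\alpha)(x)\Big)\to\Big(\int f_1(x)\,dM_{\alpha(u)}(x),\dots,\int f_d(x)\,dM_{\alpha(u)}(x)\Big)$$ in distribution as $r\to0$ ($r>0$). In particular, $$r^{-1/\alpha(u)}\big((T_{u,r}^{\#}M_\alpha)(A_1),\dots,(T_{u,r}^{\#}M_\alpha)(A_d)\big)\to\big(M_{\alpha(u)}(A_1),\dots,M_{\alpha(u)}(A_d)\big)$$ in distribution as $r\to0$, for all bounded sets $A_1,\dots,A_d\in\mathcal{E}_0$.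
   Context: Let $\mathcal{E}_0$ be the collection of Lebesgue measurable subsets of $\mathbb{R}$ of finite Lebesgue measure. $\mathcal{F}_{a,b}$ is the space of measurable $f:\mathbb{R}\to\mathbb{R}$ with $\int\max\{|f(x)|^a,|f(x)|^b\}dx<\infty$. For measurable $\alpha:\mathbb{R}\to[a,b]$, $\mathcal{F}_\alpha$ is the space of measurable $f$ with $\int|f(x)|^{\alpha(x)}dx<\infty$; $\mathcal{F}_{a,b}\subseteq\mathcal{F}_\alpha$. The $\alpha(x)$-multistable integral is a stochastic process $\{I(f):f\in\mathcal{F}_\alpha\}$ with $$\mathbb{E}\Big(\exp i\sum_{j=1}^d\theta_jI(f_j)\Big)=\exp\Big\{-\int\Big|\sum_{j=1}^d\theta_jf_j(x)\Big|^{\alpha(x)}dx\Big\}$$ for all $d\in\mathbb{N}$, $f_1,\dots,f_d\in\mathcal{F}_\alpha$, $\theta_1,\dots,\theta_d\in\mathbb{R}$ (such a process exists). One writes $\int f\,dM_\alpha:=I(f)$ and $M_\alpha(A):=I(\mathbf{1}_A)$, $A\in\mathcal{E}_0$. $M_{\alpha(u)}$ denotes the same object for the constant index function equal to $\alpha(u)$ (the $\alpha(u)$-stable measure). For $u\in\mathbb{R}$, $r>0$, let $T_{u,r}(x)=(x-u)/r$. The scaled integrals and measures are $$\int f(x)\,d(T_{u,r}^{\#}M_\alpha)(x)=\int f\Big(\frac{x-u}{r}\Big)dM_\alpha(x)=I\Big(f\Big(\frac{\cdot-u}{r}\Big)\Big),\qquad(T_{u,r}^{\#}M_\alpha)(A)=M_\alpha(T_{u,r}^{-1}(A)).$$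 *)

(* Defs.v *)
From HB Require Import structures.
From mathcomp Require Import all_boot all_order all_algebra.
From mathcomp Require Import complex.
From mathcomp Require Import all_classical all_reals all_analysis.

Set Implicit Arguments.
Unset Strict Implicit.
Unset Printing Implicit Defensive.

Import Order.TTheory GRing.Theory Num.Theory.
Import numFieldNormedType.Exports.

Local Open Scope classical_set_scope.
Local Open Scope ring_scope.

(* The reals with the Lebesgue (as opposed to Borel) sigma-algebra, which is
   the one on which [completed_lebesgue_measure] is defined. *)
Notation lebesgueTypeR R := (caratheodory_type ((@wlength R idfun)^*)%mu).
Notation leb := completed_lebesgue_measure.

Section FunctionSpaces.
Context {R : realType}.

(* [a `^ p] is the real power, with [0 `^ p = 0] as soon as [p != 0]. *)
Definition Fab (a b : R) : set (R -> R) :=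
  [set f | measurable_fun setT (f : lebesgueTypeR R -> R) /\
    (\int[leb]_x (Num.max (`|f x| `^ a) (`|f x| `^ b))%:E < +oo)%E].

Definition Fvar (alpha : R -> R) : set (R -> R) :=
  [set f | measurable_fun setT (f : lebesgueTypeR R -> R) /\
    (\int[leb]_x (`|f x| `^ alpha x)%:E < +oo)%E].

Definition E0 : set (set R) :=
  [set A | measurable (A : set (lebesgueTypeR R)) /\ (leb A < +oo)%E].

Definition compactly_supported (f : R -> R) : Prop :=
  compact (closure [set x | f x != 0]).

(* The supremum is taken in the extended reals, so that it is meaningful
   without assuming [alpha] bounded; the nonemptiness condition is there because
   the extended supremum of the empty set is -oo. *)
Definition little_o_inv_log (alpha : R -> R) : Prop :=
  forall J : set R, is_interval J -> bounded_set J -> J !=set0 ->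
    ereal_sup [set (`|alpha (x + r) - alpha x| * `|ln r|)%:E | x in J]
      @[r --> 0^'+] --> 0%E.

End FunctionSpaces.

Section CharacteristicFunction.
Context d {T : measurableType d} {R : realType}.
Local Open Scope complex_scope.

Definition expi (t : R) : R[i] := cos t +i* sin t.

Definition cexpectation (P : probability T R) (Z : T -> R[i]) : R[i] :=
  fine ('E_P[fun w => complex.Re (Z w)])%E +i*
  fine ('E_P[fun w => complex.Im (Z w)])%E.

End CharacteristicFunction.

Section MultistableIntegral.
Context d {T : measurableType d} {R : realType} (P : probability T R).

(* The process is indexed by all functions, but nothing is required of [I f]
   (beyond being a random variable) when [f] is not in [Fvar alpha]. *)
Definition multistable_integral (alpha : R -> R)
    (I : (R -> R) -> {RV P >-> R}) : Prop :=
  forall (n : nat) (f : 'I_n -> R -> R) (theta : 'I_n -> R),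
    (forall j, Fvar alpha (f j)) ->
    cexpectation P (fun w => expi (\sum_(j < n) theta j * I (f j) w)) =
    (expR (- (\int[leb]_x
       (`|\sum_(j < n) theta j * f j x| `^ alpha x))))%:C%C.

Variable I : (R -> R) -> {RV P >-> R}.

Definition random_measure (A : set R) : {RV P >-> R} := I \1_A.

Definition rescale (u r x : R) : R := (x - u) / r.

Definition scaled_integral (u r : R) (f : R -> R) : {RV P >-> R} :=
  I (f \o rescale u r).

Definition scaled_measure (u r : R) (A : set R) : {RV P >-> R} :=
  random_measure (rescale u r @^-1` A).

End MultistableIntegral.

(* Weak convergence of the laws. The limit may live on another probability
   space than the converging family. *)
Definition cvg_in_distribution {R : realType} {V : topologicalType} {K : Type}
    d {T : measurableType d} (P : probability T R) (X : K -> T -> V)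
    (F : set_system K)
    d' {T' : measurableType d'} (P' : probability T' R) (Y : T' -> V) : Prop :=
  forall g : V -> R, continuous g -> bounded_fun g ->
    ('E_P[g \o X k] @[k --> F] --> 'E_P'[g \o Y])%E.

(* Main.v *)
Require Import Defs.
From HB Require Import structures.
From mathcomp Require Import all_boot all_order all_algebra.
From mathcomp Require Import complex ring lra.
From mathcomp Require Import all_classical all_reals all_analysis.
From mathcomp Require Import measurable_realfun.

Set Implicit Arguments.
Unset Strict Implicit.
Unset Printing Implicit Defensive.

Import Order.TTheory GRing.Theory Num.Theory.
Import numFieldNormedType.Exports.

Local Open Scope classical_set_scope.
Local Open Scope ring_scope.

(** The joint characteristic function of the rescaled integrals at [theta] is
    [exp (- J r)] where, after the substitution [x = u + r z],
    [J r = \int r ^ (1 - alpha (u + r z) / alpha u) |F z| ^ alpha (u + r z) dz]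
    and [F = \sum_j theta_j f_j]. On a bounded set of [z] the weight
    [r ^ (1 - alpha (u + r z) / alpha u)] tends to [1] uniformly: its logarithm is
    [ln r * (alpha u - alpha (u + r z)) / alpha u], which the hypothesis on the
    modulus of continuity of [alpha] makes small ([near_exponent_log]). Since [F]
    has compact support and [max (|F|^a, |F|^b)] is integrable, dominated
    convergence ([cvg_integral_weighted_powR]) gives
    [J r --> \int |F z| ^ alpha u dz], which is the exponent of the limit
    ([cvg_rescaled_exponent]). The substitution ([integral_rescale]) rests on
    the scaling of the outer Lebesgue measure.

    It remains to pass from characteristic functions to laws, which is Levy's
    continuity theorem ([cvg_in_distribution_char]). A bounded continuous
    function of a random vector is approximated uniformly on a large cube by a
    trigonometric polynomial which is bounded, independently of the precision,
    everywhere else ([trig_approx]). Such a polynomial is a multivariate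
    Bernstein polynomial in the variables [sin (c x_j)]. The contribution of the
    complement of the cube is controlled by tightness. For the latter no averaging
    of the characteristic function [phi] is needed, because here
    [1 - phi t <= C t ^ a] for [0 < t <= 1] with the same [C] for all small [r]:
    then [P (K < |X| <= 2 K)] is at most a multiple of [1 - phi (1 / K)],
    hence of [K ^ (- a)], and these bounds are summable over dyadic [K]
    ([tail_uniform]). The statement on measures is the case of indicator
    functions. *)

(** * Trigonometric polynomials *)

Section TrigonometricPolynomials.
Context {R : realType} {n : nat}.
Implicit Types h : 'rV[R]_n -> R.

(** Real linear combinations of the functions [cos (<theta, x> + c)]: the phase
    [c] provides the sines, and makes the product-to-sum formula a single case. *)
Inductive trigpoly : ('rV[R]_n -> R) -> Prop :=
| trig_cos (theta : 'I_n -> R) c :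
    trigpoly (fun x => cos (\sum_(j < n) theta j * x ord0 j + c))
| trig_add h1 h2 : trigpoly h1 -> trigpoly h2 -> trigpoly (fun x => h1 x + h2 x)
| trig_scale (a : R) h : trigpoly h -> trigpoly (fun x => a * h x).

Lemma trig_cst (a : R) : trigpoly (fun=> a).
Proof.
rewrite (_ : (fun _ => _) =
    (fun x : 'rV[R]_n => a * cos (\sum_(j < n) 0 * x ord0 j + 0))).
  exact/trig_scale/trig_cos.
apply/funext => x; rewrite big1 ?addr0 ?cos0 ?mulr1 // => j _.
by rewrite mul0r.
Qed.

Lemma trig_mul h1 h2 :
  trigpoly h1 -> trigpoly h2 -> trigpoly (fun x => h1 x * h2 x).
Proof.
elim=> [th1 c1|k1 k2 _ ih1 _ ih2 t2|a k _ ih t2]; last 2 first.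
- rewrite (_ : (fun _ => _) = (fun x => k1 x * h2 x + k2 x * h2 x)).
    by apply: trig_add; [exact: ih1|exact: ih2].
  by apply/funext => x; rewrite mulrDl.
- rewrite (_ : (fun _ => _) = (fun x => a * (k x * h2 x))).
    exact/trig_scale/ih.
  by apply/funext => x; rewrite mulrA.
elim=> [th2 c2|k1 k2 _ ih1 _ ih2|a k _ ih]; last 2 first.
- rewrite (_ : (fun _ => _) = (fun x : 'rV[R]_n =>
    cos (\sum_(j < n) th1 j * x ord0 j + c1) * k1 x +
    cos (\sum_(j < n) th1 j * x ord0 j + c1) * k2 x)).
    exact: trig_add.
  by apply/funext => x; rewrite mulrDr.
- rewrite (_ : (fun _ => _) = (fun x : 'rV[R]_n =>
    a * (cos (\sum_(j < n) th1 j * x ord0 j + c1) * k x))).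
    exact: trig_scale.
  by apply/funext => x; rewrite mulrCA.
rewrite (_ : (fun _ => _) = (fun x : 'rV[R]_n =>
    2^-1 * (cos (\sum_(j < n) (th1 j + th2 j) * x ord0 j + (c1 + c2)) +
            cos (\sum_(j < n) (th1 j - th2 j) * x ord0 j + (c1 - c2))))).
  by apply/trig_scale/trig_add; exact: trig_cos.
apply/funext => x.
under [in RHS]eq_bigr do rewrite mulrDl.
under [X in _ + cos (X + _)]eq_bigr do rewrite mulrBl.
rewrite big_split/= sumrB.
set A := \sum_(j < n) th1 j * _; set B := \sum_(j < n) th2 j * _.
rewrite (_ : A + B + (c1 + c2) = (A + c1) + (B + c2)); last by ring.
rewrite (_ : A - B + (c1 - c2) = (A + c1) - (B + c2)); last by ring.
by move: (A + c1) (B + c2) => y z; rewrite cosD cosB; field.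
Qed.

Lemma trig_sum (J : Type) (s : seq J) (F : J -> 'rV[R]_n -> R) :
  (forall i, trigpoly (F i)) -> trigpoly (fun x => \sum_(i <- s) F i x).
Proof.
move=> tF; elim: s => [|i s ih].
  rewrite (_ : (fun _ => _) = (fun=> 0)); first exact: trig_cst.
  by apply/funext => x; rewrite big_nil.
rewrite (_ : (fun _ => _) = (fun x => F i x + \sum_(i <- s) F i x)).
  exact: trig_add.
by apply/funext => x; rewrite big_cons.
Qed.

Lemma trig_prod (J : Type) (s : seq J) (F : J -> 'rV[R]_n -> R) :
  (forall i, trigpoly (F i)) -> trigpoly (fun x => \prod_(i <- s) F i x).
Proof.
move=> tF; elim: s => [|i s ih].
  rewrite (_ : (fun _ => _) = (fun=> 1)); first exact: trig_cst.
  by apply/funext => x; rewrite big_nil.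
rewrite (_ : (fun _ => _) = (fun x => F i x * \prod_(i <- s) F i x)).
  exact: trig_mul.
by apply/funext => x; rewrite big_cons.
Qed.

Lemma trig_exp h m : trigpoly h -> trigpoly (fun x => h x ^+ m).
Proof.
move=> th; elim: m => [|m ih].
  rewrite (_ : (fun _ => _) = (fun=> 1)); first exact: trig_cst.
  by apply/funext => x; rewrite expr0.
rewrite (_ : (fun _ => _) = (fun x => h x * h x ^+ m)); first exact: trig_mul.
by apply/funext => x; rewrite exprS.
Qed.

Lemma trig_sin_coord (a : R) (i : 'I_n) : trigpoly (fun x => sin (a * x ord0 i)).
Proof.
rewrite (_ : (fun _ => _) = (fun x : 'rV[R]_n =>
    cos (\sum_(j < n) (if j == i then a else 0) * x ord0 j + (- (pi / 2))))).
  exact: trig_cos.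
apply/funext => x; rewrite (bigD1 i)//= eqxx big1 ?addr0 ?cosBpihalf//.
by move=> j /negPf ->; rewrite mul0r.
Qed.

End TrigonometricPolynomials.

(** * Bernstein polynomials *)

Section Bernstein.
Context {R : realType}.
Implicit Types (m : nat) (t : R).

Definition bernstein m (i : nat) t : R :=
  'C(m, i)%:R * (t ^+ i * (1 - t) ^+ (m - i)).

Lemma bernstein_ge0 m i t : 0 <= t <= 1 -> 0 <= bernstein m i t.
Proof.
by move=> /andP[t0 t1]; rewrite /bernstein !mulr_ge0// exprn_ge0// subr_ge0.
Qed.

(** Pascal's rule: the outcome of the last of [m + 1] Bernoulli trials is
    split off. *)
Lemma bernstein_sumS m t (p : nat -> R) :
  \sum_(i < m.+2) bernstein m.+1 i t * p i =
  t * (\sum_(i < m.+1) bernstein m i t * p i.+1) +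
  (1 - t) * (\sum_(i < m.+1) bernstein m i t * p i).
Proof.
rewrite [LHS]big_ord_recl/= [X in _ = _ + _ * X]big_ord_recl/=.
have pascal (i : 'I_m.+1) : bernstein m.+1 i.+1 t * p i.+1 =
    'C(m, i.+1)%:R * (t ^+ i.+1 * (1 - t) ^+ (m - i)) * p i.+1 +
    t * (bernstein m i t * p i.+1).
  by rewrite /bernstein binS subSS natrD exprS; ring.
rewrite (eq_bigr _ (fun i _ => pascal i)) big_split/= -mulr_sumr.
rewrite [X in _ + (X + _) = _]big_ord_recr/= bin_small// !mul0r addr0.
have -> : \sum_(i < m) 'C(m, i.+1)%:R * (t ^+ i.+1 * (1 - t) ^+ (m - i)) * p i.+1
    = (1 - t) * \sum_(i < m) bernstein m i.+1 t * p i.+1.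
  rewrite mulr_sumr; apply: eq_bigr => i _.
  by rewrite /bernstein -(subnSK (ltn_ord i)) [(1 - t) ^+ _.+1]exprS; ring.
have b0 k : bernstein k 0 t = (1 - t) ^+ k.
  by rewrite /bernstein bin0 subn0 expr0 !mul1r.
have -> : \sum_(i < m) bernstein m (bump 0 i) t * p (bump 0 i) =
    \sum_(i < m) bernstein m i.+1 t * p i.+1 by [].
by rewrite !b0 exprS; ring.
Qed.

Lemma bernstein_sum1 m t : \sum_(i < m.+1) bernstein m i t = 1.
Proof.
elim: m => [|m ih]; first by rewrite big_ord1 /bernstein bin0 !expr0; ring.
under eq_bigr do rewrite -[bernstein _ _ _]mulr1.
rewrite (bernstein_sumS m t (fun=> 1)).
by under eq_bigr do rewrite mulr1; rewrite ih; ring.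
Qed.

(** The second moment of a binomial variable about an arbitrary point [c]; the
    induction needs it about [c - 1] as well. *)
Lemma bernstein_sqr m t c :
  \sum_(i < m.+1) bernstein m i t * (i%:R - c) ^+ 2 =
  (m%:R * t - c) ^+ 2 + m%:R * (t * (1 - t)).
Proof.
elim: m c => [|m ih] c.
  by rewrite big_ord1 /bernstein/= bin0 subn0 !expr0; ring.
rewrite (bernstein_sumS m t (fun i => (i%:R - c) ^+ 2)) ih.
under eq_bigr => i _.
  rewrite -natr1 (_ : i%:R + 1 - c = i%:R - (c - 1)); last by ring.
  over.
by rewrite ih -natr1; ring.
Qed.

End Bernstein.

Lemma heine_cantor {R : realType} {V : pseudoMetricType R} (K : set V)
    (f : V -> R) (e : R) : compact K -> continuous f -> 0 < e ->
  exists2 delta, 0 < delta &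
    forall x y, K x -> ball x delta y -> `|f x - f y| < e.
Proof.
move=> /compact_near_coveringP cK cf e0.
pose Q (r : R) (x : V) := forall y, ball x r y -> `|f x - f y| < e.
have : \forall r \near 0^'+, K `<=` Q r.
  apply: cK => x Kx.
  have /cvgrPdist_lt/(_ (e / 2)) := cf x.
  rewrite divr_gt0// => /(_ isT)/nbhs_ballP[eta/= eta0 Hx].
  exists (ball x (eta / 2), [set r | 0 < r < eta / 2]).
    split; first exact/nbhsx_ballx/divr_gt0.
    near=> r; apply/andP; split => //.
    by near: r; apply: nbhs_right_lt; rewrite divr_gt0.
  move=> [x' r]/= [xx' /andP[r0 re]] y x'y.
  have fx' : `|f x - f x'| < e / 2.
    by apply: Hx => /=; apply: le_ball xx'; rewrite ler_pdivrMr//; lra.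
  have fy : `|f x - f y| < e / 2.
    apply: Hx; rewrite [eta]splitr; apply: (ball_triangle xx').
    exact/(le_ball (ltW re)).
  rewrite [e]splitr (_ : f x' - f y = (f x - f y) - (f x - f x')); last by ring.
  by rewrite (le_lt_trans (ler_normB _ _))// ltrD.
move=> [r/= r0 Hr]; exists (r / 2); first by rewrite divr_gt0.
move=> x y Kx xy; apply: (Hr (r / 2)) => //=.
  by rewrite sub0r normrN gtr0_norm ?divr_gt0//; lra.
by rewrite divr_gt0.
Unshelve. all: by end_near. Qed.

Section MultivariateBernstein.
Context {R : realType} {n : nat}.
Implicit Types (m : nat) (t : 'rV[R]_n).

Local Notation grid m := {ffun 'I_n -> 'I_m.+1}.

Definition bernstein_weight m (k : grid m) t : R :=
  \prod_(j < n) bernstein m (k j) (t ord0 j).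

Definition grid_point m (k : grid m) : 'rV[R]_n := \row_(j < n) ((k j)%:R / m%:R).

Definition bernstein_poly m (G : 'rV[R]_n -> R) t : R :=
  \sum_(k : grid m) bernstein_weight k t * G (grid_point k).

Definition unit_cube : set 'rV[R]_n := [set t | forall j, 0 <= t ord0 j <= 1].

Lemma bernstein_weight_ge0 m (k : grid m) t :
  unit_cube t -> 0 <= bernstein_weight k t.
Proof. by move=> t01; apply: prodr_ge0 => j _; exact/bernstein_ge0/t01. Qed.

Lemma bernstein_weight_sum1 m t : \sum_(k : grid m) bernstein_weight k t = 1.
Proof.
rewrite /bernstein_weight.
rewrite -(bigA_distr_bigA (fun j (i : 'I_m.+1) => bernstein m i (t ord0 j))).
by rewrite big1// => j _; exact: bernstein_sum1.
Qed.

(** The weights make the coordinates independent binomial variables, so this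
    is the variance of a single one. *)
Lemma bernstein_weight_variance m t (i : 'I_n) : (0 < m)%N ->
  \sum_(k : grid m) bernstein_weight k t * (grid_point k ord0 i - t ord0 i) ^+ 2
  = t ord0 i * (1 - t ord0 i) / m%:R.
Proof.
move=> m0; have mn0 : m%:R != 0 :> R by rewrite pnatr_eq0 -lt0n.
pose F (j : 'I_n) (l : 'I_m.+1) := bernstein m l (t ord0 j) *
  (if j == i then (l%:R / m%:R - t ord0 i) ^+ 2 else 1).
transitivity (\sum_(k : grid m) \prod_(j < n) F j (k j)).
  apply: eq_bigr => k _; rewrite /F big_split/=; congr (_ * _).
  rewrite (bigD1 i)//= eqxx big1 ?mulr1 ?mxE//.
  by move=> j /negPf ->.
rewrite -bigA_distr_bigA (bigD1 i)//= [X in _ * X]big1 ?mulr1 => [|j /negPf ji].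
  rewrite /F eqxx; under eq_bigr => l _.
    rewrite (_ : _ / _ - _ = m%:R^-1 * (l%:R - m%:R * t ord0 i)); last by field.
    rewrite exprMn mulrCA; over.
  by rewrite -mulr_sumr bernstein_sqr subrr; field.
by rewrite /F ji; under eq_bigr do rewrite mulr1; exact: bernstein_sum1.
Qed.

Lemma compact_unit_cube : compact unit_cube.
Proof.
have := @rV_compact R n (fun=> `[0, 1]%classic) (fun=> @segment_compact _ 0 1).
by congr compact; apply/seteqP; split => x /= x01 j; move: (x01 j); rewrite in_itv.
Qed.

(** Bernstein's theorem, by Chebyshev's inequality: the grid points at distance
    more than [delta] from [t] have total weight [O(1 / m)]. *)
Lemma bernstein_poly_approx (G : 'rV[R]_n -> R) (M e : R) :
  continuous G -> (forall t, `|G t| <= M) -> 0 < e ->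
  exists m, forall t, unit_cube t -> `|G t - bernstein_poly m G t| <= e.
Proof.
move=> cG GM e0.
have M0 : 0 <= M by apply: le_trans (GM 0).
have [delta d0 Hd] := heine_cantor compact_unit_cube cG (divr_gt0 e0 (ltr0Sn R 1)).
pose C := 2 * M / delta ^+ 2.
have C0 : 0 <= C by apply: divr_ge0; [exact: mulr_ge0|exact: sqr_ge0].
have pw t (k : 'rV[R]_n) : unit_cube t -> `|G t - G k| <=
    e / 2 + C * \sum_(j < n) (k ord0 j - t ord0 j) ^+ 2.
  move=> t01; have S0 : 0 <= \sum_(j < n) (k ord0 j - t ord0 j) ^+ 2.
    by apply: sumr_ge0 => j _; exact: sqr_ge0.
  have [near_tk|] := pselect (ball t delta k).
    by rewrite (le_trans (ltW (Hd _ _ t01 near_tk)))// lerDl mulr_ge0.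
  move=> far; have [j Hj] : exists j, delta <= `|t ord0 j - k ord0 j|.
    apply: contrapT => /forallNP H; apply: far; split => // i j.
    by rewrite !ord1 /ball/= ltNge; exact/negP/H.
  apply: (@le_trans _ _ (2 * M)).
    by rewrite (le_trans (ler_normB _ _))// mulr_natl mulr2n lerD.
  rewrite (@le_trans _ _ (C * delta ^+ 2))//.
    by rewrite /C divfK// lt0r_neq0// exprn_gt0.
  rewrite -[leLHS]add0r; apply: lerD; first by rewrite ltW ?divr_gt0.
  rewrite ler_wpM2l// (bigD1 j)//= -[leLHS]addr0 lerD//; last first.
    by apply: sumr_ge0 => i _; exact: sqr_ge0.
  by rewrite -[leRHS]sqrrN opprB -[leRHS]real_normK ?num_real// ler_pXn2r ?nnegrE// ltW.
pose m := (Num.truncn (C * n%:R / (e / 2))).+1.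
have m0 : (0 < m)%N by [].
exists m => t t01.
rewrite -[G t]mul1r -(bernstein_weight_sum1 m t) mulr_suml -sumrB.
rewrite (le_trans (ler_norm_sum _ _ _))//.
apply: (@le_trans _ _ (\sum_(k : grid m) bernstein_weight k t *
    (e / 2 + C * \sum_(j < n) (grid_point k ord0 j - t ord0 j) ^+ 2))).
  apply: ler_sum => k _; rewrite -mulrBr normrM ger0_norm ?bernstein_weight_ge0//.
  by rewrite ler_wpM2l ?bernstein_weight_ge0// pw.
under eq_bigr do rewrite mulrDr [_ * (C * _)]mulrCA mulr_sumr.
rewrite big_split/= -mulr_suml bernstein_weight_sum1 mul1r -mulr_sumr exchange_big/=.
under eq_bigr do rewrite bernstein_weight_variance//.
rewrite [leRHS]splitr lerD2l.
apply: (@le_trans _ _ (C * (n%:R / m%:R))).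
  rewrite ler_wpM2l// mulr_natl -[n in leRHS]card_ord -sumr_const.
  apply: ler_sum => j _; rewrite ler_pdivrMr ?ltr0n// mulVf ?pnatr_eq0//.
  by have /andP[t0 t1] := t01 j; rewrite mulr_ile1// ?subr_ge0// lerBlDr lerDl.
rewrite mulrA ler_pdivrMr ?ltr0n// [leRHS]mulrC -ler_pdivrMr ?divr_gt0//.
exact/ltW/truncnS_gt.
Qed.

Lemma trig_bernstein_poly m (G : 'rV[R]_n -> R) (tau : 'rV[R]_n -> 'rV[R]_n) :
  (forall j, trigpoly (fun x => tau x ord0 j)) ->
  trigpoly (fun x => bernstein_poly m G (tau x)).
Proof.
move=> ttau; apply: trig_sum => k; apply: trig_mul; last exact: trig_cst.
apply: trig_prod => j; apply: trig_mul; first exact: trig_cst.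
apply: trig_mul; apply: trig_exp => //.
rewrite (_ : (fun _ => _) = (fun x => 1 + (-1) * tau x ord0 j)).
  by apply: trig_add; [exact: trig_cst|exact: trig_scale].
by apply/funext => x; rewrite mulN1r.
Qed.

End MultivariateBernstein.

(** * Approximation by trigonometric polynomials *)

Lemma continuous_row {R : realType} {V : topologicalType} n (F : V -> 'I_n -> R) :
  (forall j, continuous (F^~ j)) -> continuous (fun v => \row_(j < n) F v j).
Proof.
move=> cF v; apply/cvg_ballP => e e0.
have : \forall w \near v, forall j, ball (F v j) e (F w j).
  by apply: filter_forall => j; have /cvg_ballP := cF j v; exact.
by apply: filterS => w Hw; split => // i j; rewrite !mxE.
Qed.

(** Truncation to the interval [-1/2, 1/2], which keeps the argument of [asin] away from
    the end points of its domain. *)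
Definition clip {R : realType} (y : R) : R := (`|y + 2^-1| - `|y - 2^-1|) / 2.

Lemma clip_id {R : realType} (y : R) : `|y| <= 2^-1 -> clip y = y.
Proof.
rewrite ler_norml /clip => /andP[y1 y2].
by rewrite ger0_norm ?ler0_norm; lra.
Qed.

Lemma continuous_asin_clip {R : realType} : continuous (@asin R \o clip).
Proof.
move=> y; apply: continuous_comp; last first.
  apply: continuous_asin.
  rewrite -ltr_norml /clip normrM [`|2^-1|]ger0_norm ?invr_ge0// ltr_pdivrMr//.
  have := ler_dist_dist (y + 2^-1) (y - 2^-1).
  rewrite (_ : y + 2^-1 - (y - 2^-1) = 1) ?normr1; lra.
apply: cvgM; last exact: cvg_cst.
by apply: cvgB; apply: cvg_norm;
  [apply: cvgD|apply: cvgB]; (exact: cvg_id || exact: cvg_cst).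
Qed.

(** For a small [c] the numbers [sin (c x_j)] determine [x] on the cube
    [|x_j| <= L], so that [g] coincides there with a continuous function [G] of
    these sines which is bounded by [M] everywhere. A Bernstein polynomial
    approximates [G] uniformly on the whole range of the sines; outside the cube
    it is thus within [e] of a number bounded by [M]. *)
Lemma trig_approx {R : realType} {n : nat} (g : 'rV[R]_n -> R) (M L e : R) :
  continuous g -> (forall x, `|g x| <= M) -> 0 < L -> 0 < e ->
  exists2 p, trigpoly p & forall x,
    `|g x - p x| <= e + 2 * M * \sum_(j < n) (L < `|x ord0 j|)%R%:R.
Proof.
move=> cg gM L0 e0.
have M0 : 0 <= M by apply: le_trans (gM 0).
have [eta /andP[eta0 eta1] sin_le] :
    exists2 eta : R, 0 < eta <= 1 & forall y, `|y| <= eta -> `|sin y| <= 2^-1.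
  have /cvgrPdist_le/(_ 2^-1) := @continuous_sin R 0.
  rewrite invr_gt0 ltr0n => /(_ isT)[r /= r0 Hr].
  exists (Num.min (r / 2) 1); first by rewrite lt_min ge_min divr_gt0// ltr01 lexx orbT.
  move=> y; rewrite le_min => /andP[yr _].
  have := Hr y; rewrite /= sin0 !sub0r !normrN; apply.
  by rewrite (le_lt_trans yr)// ltr_pdivrMr//; lra.
pose c := eta / L; have c0 : 0 < c by rewrite divr_gt0.
pose G (t : 'rV[R]_n) := g (\row_(j < n) (c^-1 * asin (clip (2 * t ord0 j - 1)))).
have cG : continuous G.
  pose F (t : 'rV[R]_n) j := c^-1 * asin (clip (2 * t ord0 j - 1)).
  suff crow : continuous (fun t => \row_(j < n) F t j).
    by move=> t; exact: (continuous_comp (crow t) (cg _)).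
  apply: continuous_row => j t.
  have c2 : (2 * s ord0 j - 1) @[s --> t] --> 2 * t ord0 j - 1.
    exact: cvgB (cvgM (cvg_cst _) (@coord_continuous _ _ _ _ _ _)) (cvg_cst _).
  have ac2 := continuous_comp c2 (@continuous_asin_clip R _).
  exact: (cvgM (cvg_cst _) ac2).
have [m Hm] := bernstein_poly_approx cG (fun t => gM _) e0.
(* The sines are brought to the unit interval. *)
pose tau (x : 'rV[R]_n) : 'rV[R]_n := \row_(j < n) (2^-1 + 2^-1 * sin (c * x ord0 j)).
exists (fun x => bernstein_poly m G (tau x)).
  apply: trig_bernstein_poly => j.
  rewrite (_ : (fun _ => _) = (fun x : 'rV[R]_n => 2^-1 + 2^-1 * sin (c * x ord0 j))).
    by apply: trig_add; [exact: trig_cst|exact/trig_scale/trig_sin_coord].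
  by apply/funext => x; rewrite mxE.
move=> x; have tau01 : unit_cube (tau x).
  move=> j; rewrite mxE; have := sin_geN1 (c * x ord0 j).
  by have := sin_le1 (c * x ord0 j); lra.
rewrite (_ : g x - _ = (G (tau x) - bernstein_poly m G (tau x)) + (g x - G (tau x)));
  last by ring.
rewrite (le_trans (ler_normD _ _))// lerD ?Hm//.
have [/existsP[j Hj]|/existsPn Hx] := boolP [exists j, L < `|x ord0 j|].
  apply: (@le_trans _ _ (2 * M)).
    by rewrite (le_trans (ler_normB _ _))// mulr_natl mulr2n lerD// gM.
  rewrite ler_peMr ?mulr_ge0// (bigD1 j)//= Hj lerDl.
  exact: sumr_ge0.
rewrite (_ : G (tau x) = g x); first by rewrite subrr normr0 !mulr_ge0// sumr_ge0.
congr g; apply/rowP => j; rewrite !mxE.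
rewrite (_ : 2 * _ - 1 = sin (c * x ord0 j)); last by field.
have cx : `|c * x ord0 j| <= eta.
  rewrite normrM gtr0_norm// /c mulrAC ler_pdivrMr// ler_pM2l//.
  by have := Hx j; rewrite -leNgt.
rewrite clip_id ?sin_le// sinK ?mulKf ?lt0r_neq0//.
rewrite in_itv/= -ler_norml (le_trans cx)// (le_trans eta1)//.
by rewrite ler_pdivlMr// mul1r pi_ge2.
Qed.

(** * Convergence of characteristic functions and of laws *)

Section RandomVectors.
Context {R : realType} {n : nat} {d} {T : measurableType d} (P : probability T R).
Implicit Types (X : T -> 'rV[R]_n) (h : T -> R).

Lemma bounded_measurable_integrable h (M : R) :
  measurable_fun setT h -> (forall w, `|h w| <= M) ->
  P.-integrable setT (EFin \o h).
Proof.
move=> mh hM; apply: measurable_bounded_integrable => //.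
  by rewrite (le_lt_trans (probability_le1 _ _))// ltry.
exists M; split; first exact: num_real.
by move=> y My w _; rewrite /= (le_trans (hM w))// ltW.
Qed.

Lemma expectation_Rintegral h (M : R) :
  measurable_fun setT h -> (forall w, `|h w| <= M) ->
  ('E_P[h] = (\int[P]_w h w)%:E)%E.
Proof.
move=> mh hM; rewrite unlock /Rintegral fineK// integrable_fin_num//.
exact: bounded_measurable_integrable hM.
Qed.

Variable X : T -> 'rV[R]_n.
Hypothesis mX : forall j, measurable_fun setT (fun w => X w ord0 j).

Lemma trigpoly_bounded (p : 'rV[R]_n -> R) :
  trigpoly p -> exists M, forall x, `|p x| <= M.
Proof.
elim=> [th c|h1 h2 _ [M1 H1] _ [M2 H2]|a h _ [M H]].
- by exists 1 => x; exact: cos_max.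
- by exists (M1 + M2) => x; rewrite (le_trans (ler_normD _ _))// lerD.
- by exists (`|a| * M) => x; rewrite normrM ler_wpM2l.
Qed.

Lemma measurable_linear_form (th : 'I_n -> R) :
  measurable_fun setT (fun w => \sum_(j < n) th j * X w ord0 j).
Proof. by apply: measurable_sum => j; exact: measurable_funM. Qed.

Lemma measurable_trigpoly (p : 'rV[R]_n -> R) :
  trigpoly p -> measurable_fun setT (p \o X).
Proof.
elim=> [th c|h1 h2 _ mh1 _ mh2|a h _ mh].
- apply: (measurableT_comp (continuous_measurable_fun (@continuous_cos R))).
  by apply: measurable_funD => //; exact: measurable_linear_form.
- exact: measurable_funD.
- exact: measurable_funM.
Qed.

Lemma measurable_tail (L : R) j :
  measurable [set w | L < `|X w ord0 j|].
Proof.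
rewrite -[X in measurable X]setTI.
have := @measurable_fun_ltr _ T R setT (cst L) (fun w => `|X w ord0 j|).
move=> /(_ (measurable_cst _) (measurableT_comp (@normr_measurable R setT) (mX j))).
move=> /(_ measurableT [set true] I).
by congr measurable; apply/seteqP; split => w /=.
Qed.

(** Measurability is inherited from the coordinates of [X] because [g] is a
    pointwise limit of trigonometric polynomials. *)
Lemma measurable_continuous_row (g : 'rV[R]_n -> R) (M : R) :
  continuous g -> (forall x, `|g x| <= M) -> measurable_fun setT (g \o X).
Proof.
move=> cg gM.
have /choice[p Hp] : forall m, exists p : 'rV[R]_n -> R, trigpoly p /\ forall x,
    `|g x - p x| <= m.+1%:R^-1 + 2 * M * \sum_(j < n) (m.+1%:R < `|x ord0 j|)%R%:R.
  move=> m; have m0 : 0 < m.+1%:R :> R by [].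
  have [p tp Hp] := trig_approx cg gM m0 (divr_gt0 ltr01 m0).
  by exists p; split => // x; have := Hp x; rewrite div1r.
apply: (@measurable_fun_cvg _ _ _ _ (fun m => p m \o X)).
  by move=> m; exact: measurable_trigpoly (Hp m).1.
move=> w _; apply/cvgrPdist_le => e e0.
near=> m; rewrite /=; apply: (le_trans ((Hp m).2 _)).
rewrite big1 ?mulr0 ?addr0 => [|j _].
  rewrite invf_ple ?posrE//; near: m.
  exists (Num.truncn e^-1) => // m /= em.
  by rewrite (le_trans (ltW (truncnS_gt _)))// ler_nat ltnS.
apply/eqP; rewrite pnatr_eq0 eqb0 -leNgt.
rewrite (le_trans (_ : _ <= \sum_(i < n) `|X w ord0 i|))//.
  by rewrite (bigD1 j)//= lerDl sumr_ge0.
near: m; exists (Num.truncn (\sum_(i < n) `|X w ord0 i|)) => // m /= em.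
by rewrite (le_trans (ltW (truncnS_gt _)))// ler_nat ltnS.
Unshelve. all: by end_near. Qed.

Lemma Rintegral_dist_tail (g p : 'rV[R]_n -> R) (M L e : R) :
  measurable_fun setT (g \o X) -> (forall x, `|g x| <= M) -> 0 <= M ->
  trigpoly p ->
  (forall x, `|g x - p x| <= e + 2 * M * \sum_(j < n) (L < `|x ord0 j|)%R%:R) ->
  `|\int[P]_w g (X w) - \int[P]_w p (X w)| <=
    e + 2 * M * \sum_(j < n) fine (P [set w | L < `|X w ord0 j|]).
Proof.
move=> mg gM M0 tp Hp.
have [Mp HMp] := trigpoly_bounded tp.
have ig := bounded_measurable_integrable mg (fun w => gM (X w)).
have ip := bounded_measurable_integrable (measurable_trigpoly tp) (fun w => HMp (X w)).
pose B j : set T := [set w | L < `|X w ord0 j|].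
have mB j : measurable (B j) by exact: measurable_tail.
pose b (w : T) : R := e + 2 * M * \sum_(j < n) \1_(B j) w.
have bE w : b w = e + 2 * M * \sum_(j < n) (L < `|X w ord0 j|)%R%:R.
  rewrite /b; congr (_ + _ * _); apply: eq_bigr => j _.
  by rewrite indicE; congr (nat_of_bool _)%:R; rewrite mem_setE.
have iB : P.-integrable setT (EFin \o (fun w => \sum_(j < n) (\1_(B j) w : R))).
  apply: (@bounded_measurable_integrable _ n%:R).
    by apply: measurable_sum => j; exact: measurable_indic.
  move=> w; rewrite ger0_norm ?sumr_ge0// -[n in leRHS]card_ord -sumr_const.
  by apply: ler_sum => j _; rewrite indicE; case: (_ \in _).
have ie : P.-integrable setT (EFin \o (fun=> e)).
  by apply: (@bounded_measurable_integrable _ `|e|).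
have iMB : P.-integrable setT
    (EFin \o (fun w => 2 * M * \sum_(j < n) (\1_(B j) w : R))).
  rewrite (_ : _ \o _ = (fun w => (2 * M)%:E * (\sum_(j < n) \1_(B j) w)%:E)%E).
    exact: integrableZl.
  by apply/funext => w /=; rewrite EFinM.
have ib : P.-integrable setT (EFin \o b).
  rewrite (_ : _ \o _ = ((EFin \o (fun=> e)) \+
    (EFin \o (fun w => 2 * M * \sum_(j < n) (\1_(B j) w : R))%R))%E).
    exact: integrableD.
  by apply/funext => w /=; rewrite EFinD.
have igp : P.-integrable setT (EFin \o (fun w => g (X w) - p (X w))).
  rewrite (_ : _ \o _ = ((EFin \o (g \o X)) \- (EFin \o (p \o X)))%E).
    exact: integrableB.
  by apply/funext => w /=; rewrite EFinB.
rewrite -RintegralB//.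
apply: (le_trans (le_normr_Rintegral _ _)) => //.
apply: (@le_trans _ _ (\int[P]_w b w)).
  apply: le_Rintegral => //.
    rewrite (_ : _ \o _ = (fun w => `|(g (X w) - p (X w))%:E|%E))//.
    exact: integrable_abse.
  by move=> w _; rewrite bE Hp.
rewrite RintegralD// Rintegral_cst//= probability_setT mulr1.
rewrite RintegralZl//= lerD2l ler_wpM2l ?mulr_ge0//.
rewrite /Rintegral.
under eq_integral do rewrite -sumEFin.
rewrite ge0_integral_sum//; last first.
  by move=> j; exact: measurableT_comp.
rewrite sum_fine => [|j _]; last exact: fin_num_measure (mB j).
by rewrite (eq_bigr (fun j => P (B j)))// => j _; rewrite integral_indic// setIT.
Qed.

End RandomVectors.

(** The class of test functions whose expectations converge is a vector space,
    and it contains the cosines of linear forms with a phase. *)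
Lemma cvg_trigpoly {R : realType} {n : nat} {K : Type} d {T : measurableType d}
    (P : probability T R) (X : K -> T -> 'rV[R]_n) (F : set_system K)
    d' {T' : measurableType d'} (P' : probability T' R) (Y : T' -> 'rV[R]_n)
    (p : 'rV[R]_n -> R) :
  Filter F ->
  (forall k j, measurable_fun setT (fun w => X k w ord0 j)) ->
  (forall j, measurable_fun setT (fun w => Y w ord0 j)) ->
  (forall th : 'I_n -> R,
    (\int[P]_w cos (\sum_(j < n) th j * X k w ord0 j)) @[k --> F] -->
    \int[P']_w cos (\sum_(j < n) th j * Y w ord0 j)) ->
  (forall th : 'I_n -> R,
    (\int[P]_w sin (\sum_(j < n) th j * X k w ord0 j)) @[k --> F] -->
    \int[P']_w sin (\sum_(j < n) th j * Y w ord0 j)) ->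
  trigpoly p ->
  (\int[P]_w p (X k w)) @[k --> F] --> \int[P']_w p (Y w).
Proof.
move=> FF mX mY Hcos Hsin.
have itrig e (S : measurableType e) (Q : probability S R) (Z : S -> 'rV[R]_n) h :
    (forall j, measurable_fun setT (fun w => Z w ord0 j)) -> trigpoly h ->
    Q.-integrable setT (EFin \o (fun w => h (Z w))).
  move=> mZ th; have [M hM] := trigpoly_bounded th.
  exact: bounded_measurable_integrable (measurable_trigpoly mZ th) (fun w => hM _).
elim=> [th c|h1 h2 t1 ih1 t2 ih2|a h th ih].
- have phase e (S : measurableType e) (Q : probability S R) (Z : S -> 'rV[R]_n) :
      (forall j, measurable_fun setT (fun w => Z w ord0 j)) ->
      \int[Q]_w cos (\sum_(j < n) th j * Z w ord0 j + c) =
      cos c * \int[Q]_w cos (\sum_(j < n) th j * Z w ord0 j) -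
      sin c * \int[Q]_w sin (\sum_(j < n) th j * Z w ord0 j).
    move=> mZ.
    have ic : Q.-integrable setT
        (EFin \o (fun w => cos (\sum_(j < n) th j * Z w ord0 j))).
      have /= := itrig _ _ Q Z _ mZ (trig_cos th 0).
      by under eq_fun do rewrite addr0.
    have isn : Q.-integrable setT
        (EFin \o (fun w => sin (\sum_(j < n) th j * Z w ord0 j))).
      have /= := itrig _ _ Q Z _ mZ (trig_cos th (- (pi / 2))).
      by under eq_fun do rewrite cosBpihalf.
    rewrite -!RintegralZl// -RintegralB//; last 2 first.
    - rewrite (_ : _ \o _ = (fun w => (cos c)%:E *
        (EFin \o (fun w => cos (\sum_(j < n) th j * Z w ord0 j))) w)%E).
        exact: integrableZl.
      by apply/funext => w.
    - rewrite (_ : _ \o _ = (fun w => (sin c)%:E *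
        (EFin \o (fun w => sin (\sum_(j < n) th j * Z w ord0 j))) w)%E).
        exact: integrableZl.
      by apply/funext => w.
    apply: eq_Rintegral => w _; rewrite cosD; ring.
  rewrite phase//; under eq_fun do rewrite phase//.
  by apply: cvgB; apply: cvgM; [exact: cvg_cst|exact: Hcos|exact: cvg_cst|exact: Hsin].
- rewrite RintegralD//; [|exact: itrig|exact: itrig].
  under eq_fun => k do rewrite RintegralD ?itrig//.
  exact: cvgD.
- rewrite RintegralZl//; last exact: itrig.
  under eq_fun => k do rewrite RintegralZl ?itrig//.
  by apply: cvgM => //; exact: cvg_cst.
Qed.

(** Levy's continuity theorem, with tightness as a hypothesis: a test function is
    replaced by a trigonometric polynomial, at a cost bounded by the tails of the
    laws, and the expectations of trigonometric polynomials converge. *)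
Lemma cvg_in_distribution_char {R : realType} {n : nat} {K : Type}
    d {T : measurableType d}
    (P : probability T R) (X : K -> T -> 'rV[R]_n) (F : set_system K)
    d' {T' : measurableType d'} (P' : probability T' R) (Y : T' -> 'rV[R]_n) :
  Filter F ->
  (forall k j, measurable_fun setT (fun w => X k w ord0 j)) ->
  (forall j, measurable_fun setT (fun w => Y w ord0 j)) ->
  (forall th : 'I_n -> R,
    (\int[P]_w cos (\sum_(j < n) th j * X k w ord0 j)) @[k --> F] -->
    \int[P']_w cos (\sum_(j < n) th j * Y w ord0 j)) ->
  (forall th : 'I_n -> R,
    (\int[P]_w sin (\sum_(j < n) th j * X k w ord0 j)) @[k --> F] -->
    \int[P']_w sin (\sum_(j < n) th j * Y w ord0 j)) ->
  (forall e, 0 < e -> exists2 L, 0 < L &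
    (forall j, fine (P' [set w | L < `|Y w ord0 j|]) <= e) /\
    \forall k \near F, forall j, fine (P [set w | L < `|X k w ord0 j|]) <= e) ->
  cvg_in_distribution P X F P' Y.
Proof.
move=> FF mX mY Hcos Hsin tight g cg bg.
have [M M0 gM] : exists2 M, 0 <= M & forall x, `|g x| <= M.
  move: bg => [M [_ HM]]; exists (`|M| + 1); first by rewrite addr_ge0.
  by move=> x; apply: HM => //; rewrite ltr_pwDr// ler_norm.
have mgX k : measurable_fun setT (g \o X k) by exact: measurable_continuous_row gM.
have mgY : measurable_fun setT (g \o Y) by exact: measurable_continuous_row gM.
rewrite (expectation_Rintegral P' mgY (fun w => gM _)).
under eq_fun => k do rewrite (expectation_Rintegral P (mgX k) (fun w => gM _)).
apply: cvg_EFin; first exact: nearW.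
apply/cvgrPdist_lt => e e0.
pose c := (2 * M * n%:R + 1); have c0 : 0 < c.
  by rewrite /c ltr_wpDl// mulr_ge0// mulr_ge0.
have e3 : 0 < e / 3 / c / 2 by rewrite !divr_gt0.
have [L L0 [tY tX]] := tight _ e3.
have [p tp Hp] := trig_approx cg gM L0 e3.
have small e' (S : measurableType e') (Q : probability S R) (Z : S -> 'rV[R]_n) :
    (forall j, measurable_fun setT (fun w => Z w ord0 j)) ->
    measurable_fun setT (g \o Z) ->
    (forall j, fine (Q [set w | L < `|Z w ord0 j|]) <= e / 3 / c / 2) ->
    `|\int[Q]_w g (Z w) - \int[Q]_w p (Z w)| < e / 3.
  move=> mZ mgZ tZ; have H := Rintegral_dist_tail Q mZ mgZ gM M0 tp Hp;
  apply: (le_lt_trans H).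
  apply: (@le_lt_trans _ _ (e / 3 / c / 2 * c)).
    move: (e / 3 / c / 2) tZ => q tZ.
    rewrite (_ : q * c = 2 * M * (n%:R * q) + q); last by rewrite /c; ring.
    rewrite addrC lerD2r ler_wpM2l ?mulr_ge0//.
    by rewrite mulr_natl -[n in leRHS]card_ord -sumr_const; apply: ler_sum.
  by rewrite mulrAC divfK ?lt0r_neq0// ltr_pdivrMr// ltr_pMr ?divr_gt0// ltr1n.
have /cvgrPdist_lt/(_ (e / 3)) := cvg_trigpoly FF mX mY Hcos Hsin tp.
rewrite divr_gt0// => /(_ isT) cp.
near=> k.
have hY := small _ _ P' Y mY mgY tY.
have hX : `|\int[P]_w g (X k w) - \int[P]_w p (X k w)| < e / 3.
  by apply: small => //; near: k.
have hp : `|\int[P']_w p (Y w) - \int[P]_w p (X k w)| < e / 3 by near: k.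
move: hY hX hp; rewrite !ltr_norml /=; lra.
Unshelve. all: by end_near. Qed.

(** * Tightness from characteristic functions *)

(** On the shell [K < |x| <= 2 K] the function [1 - cos (x / K)] is bounded
    below, so its probability is controlled by the characteristic function at
    the single point [1 / K]. *)
Lemma shell_probability {R : realType} d {T : measurableType d}
    (P : probability T R) (X : T -> R) (C a K : R) :
  measurable_fun setT X ->
  (forall t, 0 < t <= 1 -> 1 - \int[P]_w cos (t * X w) <= C * t `^ a) ->
  1 <= K ->
  fine (P [set w | K < `|X w| <= 2 * K]) <= C / (1 - cos 1) * K `^ (- a).
Proof.
move=> mX HX K1.
have K0 : 0 < K by rewrite (lt_le_trans ltr01).
have pi1 : 1 <= pi :> R by rewrite (le_trans _ (pi_ge2 R))// ler1n.
have cos1 : cos 1 < 1 :> R.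
  by rewrite -[ltRHS]cos0 ltr_cos// in_itv/= ?lexx ?pi_ge0 ?ler01.
pose B := [set w | K < `|X w| <= 2 * K].
have mX' : measurable_fun setT (fun w => `|X w|) by exact: measurableT_comp.
have mB : measurable B.
  rewrite (_ : B = (fun w => `|X w|) @^-1` `]K, (2 * K)]).
    by rewrite -[X in measurable X]setTI; exact: mX'.
  by apply/seteqP; split => w; rewrite /B/= in_itv.
have mc : measurable_fun setT (fun w => cos (K^-1 * X w)).
  apply: (measurableT_comp (continuous_measurable_fun (@continuous_cos R))).
  exact: measurable_funM.
have ic := bounded_measurable_integrable P mc (fun w => cos_max _).
have i1 : P.-integrable setT (EFin \o (fun=> 1 : R)).
  by apply: (@bounded_measurable_integrable _ _ _ P _ 1) => // w; rewrite normr1.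
have iB : P.-integrable setT (EFin \o (\1_B : T -> R)).
  apply: (@bounded_measurable_integrable _ _ _ P _ 1) => //.
  by move=> w; rewrite indicE; case: (_ \in _); rewrite ?normr1 ?normr0.
have main : (1 - cos 1) * \int[P]_w \1_B w <= \int[P]_w (1 - cos (K^-1 * X w)).
  rewrite -RintegralZl//; apply: le_Rintegral => //.
  - rewrite (_ : _ \o _ = (fun w => (1 - cos 1)%:E * (EFin \o (\1_B : T -> R)) w)%E).
      exact: integrableZl.
    by apply/funext => w.
  - rewrite (_ : _ \o _ = ((EFin \o (fun=> 1%R)) \-
      (EFin \o (fun w => cos (K^-1 * X w)%R)))%E).
      exact: integrableB.
    by apply/funext => w /=.
  move=> w _; rewrite indicE; case: (boolP (w \in B)) => wB; last first.
    by rewrite mulr0 subr_ge0 cos_le1.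
  move: wB; rewrite inE => /andP[w1 w2]; rewrite mulr1 lerD2l lerN2.
  rewrite -[leLHS]cos_norm normrM gtr0_norm ?invr_gt0//.
  have q1 : 1 <= K^-1 * `|X w| by rewrite ler_pdivlMl// mulr1 ltW.
  have q2 : K^-1 * `|X w| <= 2 by rewrite ler_pdivrMl// mulrC.
  have [->|q1'] := eqVneq (K^-1 * `|X w|) 1; first by [].
  apply/ltW; rewrite ltr_cos; first by rewrite lt_neqAle eq_sym q1'.
    by rewrite in_itv/= ler01.
  by rewrite in_itv/= (le_trans ler01 q1) (le_trans q2 (pi_ge2 R)).
have PB : \int[P]_w \1_B w = fine (P B).
  by rewrite /Rintegral integral_indic// setIT.
rewrite mulrAC ler_pdivlMr ?subr_gt0// mulrC -PB (le_trans main)//.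
rewrite RintegralB// Rintegral_cst//= probability_setT mulr1.
rewrite (_ : K `^ (- a) = K^-1 `^ a); last first.
  by rewrite -powR_inv1 ?ltW// -powRrM mulN1r.
by apply: HX; rewrite invr_gt0 K0/= invf_le1.
Qed.

(** Summing the previous bound over dyadic shells. The bound depends only on
    [C] and [a], which yields the tightness of any family of random variables
    sharing these constants. *)
Lemma tail_probability {R : realType} d {T : measurableType d}
    (P : probability T R) (X : T -> R) (C a L : R) :
  measurable_fun setT X -> 0 < a -> 0 <= C ->
  (forall t, 0 < t <= 1 -> 1 - \int[P]_w cos (t * X w) <= C * t `^ a) ->
  1 <= L ->
  fine (P [set w | L < `|X w|]) <=
    C / (1 - cos 1) / (1 - 2 `^ (- a)) * L `^ (- a).
Proof.
move=> mX a0 C0 HX L1.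
have L0 : 0 < L by rewrite (lt_le_trans ltr01).
have cos1 : 0 <= 1 - cos 1 :> R by rewrite subr_ge0 cos_le1.
pose q : R := 2 `^ (- a).
have q0 : 0 < q by exact: powR_gt0.
have q1 : q < 1.
  rewrite /q powRN invf_lt1 ?powR_gt0//.
  have powa1 : 1 `^ a = 1 :> R by rewrite powR1.
  rewrite -[ltLHS]powa1.
  by rewrite gt0_ltr_powR ?nnegrE// ltr1n.
pose D := C / (1 - cos 1) * L `^ (- a).
have D0 : 0 <= D by rewrite mulr_ge0 ?powR_ge0// divr_ge0.
have mX' : measurable_fun setT (fun w => `|X w|) by exact: measurableT_comp.
pose A := [set w | L < `|X w|].
have mA : measurable A.
  rewrite (_ : A = (fun w => `|X w|) @^-1` [set` `]L, +oo[]).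
    by rewrite -[X in measurable X]setTI; exact: mX'.
  by apply/seteqP; split => w; rewrite /A/= in_itv/= andbT.
pose B (i : nat) := [set w | 2 ^+ i * L < `|X w| <= 2 * (2 ^+ i * L)].
have mB i : measurable (B i).
  rewrite (_ : B i = (fun w => `|X w|) @^-1` `](2 ^+ i * L), (2 * (2 ^+ i * L))]).
    by rewrite -[X in measurable X]setTI; exact: mX'.
  by apply/seteqP; split => w; rewrite /B/= in_itv.
have PB i : (P (B i) <= (D * q ^+ i)%:E)%E.
  rewrite -[leLHS]fineK ?fin_num_measure// lee_fin.
  have Li : 1 <= 2 ^+ i * L by rewrite mulr_ege1// exprn_ege1// ler1n.
  apply: (le_trans (shell_probability mX HX Li)).
  have -> : (2 ^+ i * L) `^ (- a) = q ^+ i * L `^ (- a).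
    rewrite powRM ?exprn_ge0 ?ltW//; congr (_ * _).
    by rewrite -powR_mulrn// -powRrM mulrC powRrM powR_mulrn ?powR_ge0.
  by rewrite /D mulrCA mulrC.
have cover : A `<=` \bigcup_i B i.
  move=> w /= Lw.
  have ex : exists i, `|X w| <= 2 ^+ i.+1 * L.
    exists (Num.truncn `|X w|); rewrite (le_trans (ltW (truncnS_gt _)))//.
    rewrite -[leLHS]mulr1 ler_pM// -natrX ler_nat ltnW// ltn_expl//.
  case: (ex_minnP ex) => i Hi mini; exists i => //; rewrite /B/= mulrA -exprS Hi andbT.
  case: i {Hi} mini => [|i] mini; first by rewrite expr0 mul1r.
  by rewrite ltNge; apply/negP => /mini; rewrite ltnn.
have : (P A <= (D / (1 - q))%:E)%E.
  apply: (@le_trans _ _ (\sum_(i <oo) P (B i))%E).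
    exact: measure_sigma_subadditive.
  apply: lime_le; first exact: is_cvg_nneseries.
  apply: nearW => N; apply: (@le_trans _ _ (\sum_(0 <= i < N) (D * q ^+ i)%:E)%E).
    exact: lee_sum.
  rewrite sumEFin lee_fin -mulr_sumr ler_wpM2l//.
  rewrite big_mkord -[leRHS]div1r ler_pdivlMr ?subr_gt0//.
  rewrite mulrC -opprB mulNr -subrX1 opprB gerBl.
  by rewrite exprn_ge0// ltW.
move=> PL; rewrite [leRHS]mulrAC -/D -/q.
by rewrite -lee_fin fineK// fin_num_measure.
Qed.

Lemma tail_uniform {R : realType} (C a e : R) : 0 < a -> 0 <= C -> 0 < e ->
  exists2 L, 0 < L & forall d (T : measurableType d) (P : probability T R) (X : T -> R),
    measurable_fun setT X ->
    (forall t, 0 < t <= 1 -> 1 - \int[P]_w cos (t * X w) <= C * t `^ a) ->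
    fine (P [set w | L < `|X w|]) <= e.
Proof.
move=> a0 C0 e0; set D := C / (1 - cos 1) / (1 - 2 `^ (- a)).
have [D0|D0] := leP D 0.
  exists 1 => // d T P X mX HX; apply: (le_trans (tail_probability mX a0 C0 HX (lexx 1))).
  by rewrite (le_trans _ (ltW e0))// mulr_le0_ge0// powR_ge0.
exists (Num.max 1 ((D / e) `^ a^-1)); first by rewrite lt_max ltr01.
move=> d T P X mX HX.
apply: (le_trans (tail_probability mX a0 C0 HX _)); first by rewrite le_max lexx.
rewrite -/D powRN ler_pdivrMr; last by rewrite powR_gt0// lt_max ltr01.
rewrite mulrC -ler_pdivrMr// (@le_trans _ _ (((D / e) `^ a^-1) `^ a))//.
  by rewrite -powRrM mulVf ?lt0r_neq0// powRr1// ltW// divr_gt0.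
by apply: (ge0_ler_powR (ltW a0));
  rewrite ?nnegrE ?powR_ge0 ?le_max ?ler01 ?lexx ?orbT.
Qed.

(** * Affine change of variables for the completed Lebesgue measure *)

Section AffineChangeOfVariables.
Context {R : realType}.
Variables (u r : R).
Hypothesis r0 : 0 < r.

Lemma rescale_preimage_itv (a b : R) :
  rescale u r @^-1` `]a, b] = `](u + r * a), (u + r * b)]%classic.
Proof.
apply/seteqP; split => x; rewrite /= /rescale !in_itv/= ltr_pdivlMr// ler_pdivrMr//.
  by rewrite ltrBrDl lerBlDl [a * r]mulrC [b * r]mulrC.
by rewrite ltrBrDl lerBlDl [a * r]mulrC [b * r]mulrC.
Qed.

Lemma wlength_rescale (A : set R) : ocitv A ->
  ocitv (rescale u r @^-1` A) /\
  (wlength idfun (rescale u r @^-1` A) = r%:E * wlength idfun A)%E.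
Proof.
move=> [[a b] _ <-]; rewrite /= rescale_preimage_itv; split; first exact: is_ocitv.
rewrite !wlength_itv/= !lte_fin ltrD2l ltr_pM2l//.
case: ifPn => _; last by rewrite mule0.
by rewrite -!EFinB -EFinM; congr EFin; ring.
Qed.

Lemma rescaleK (x : R) : rescale (- u / r) r^-1 (rescale u r x) = x.
Proof. by rewrite /rescale invrK; field; rewrite lt0r_neq0. Qed.

Lemma rescaleVK (x : R) : rescale u r (rescale (- u / r) r^-1 x) = x.
Proof. by rewrite /rescale invrK; field; rewrite lt0r_neq0. Qed.

End AffineChangeOfVariables.

Section OuterMeasure.
Context {R : realType}.
Local Notation outer := ((@wlength R idfun)^*)%mu.

(** A countable cover by half-open intervals is transformed into such a cover,
    with lengths multiplied by [r]. Working with the outer measure makes this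
    available for all sets, which is what Caratheodory measurability needs. *)
Lemma outer_rescale_le (u r : R) (A : set R) : 0 < r ->
  (outer (rescale u r @^-1` A) <= r%:E * outer A)%E.
Proof.
move=> r0; rewrite -lee_pdivrMl//; apply: le_ereal_inf_tmp => _ [F [mF AF] <-].
rewrite lee_pdivrMl// -nneseriesZl; last by move=> i _; exact: wlength_ge0.
apply: ereal_inf_lbound; exists (fun k => rescale u r @^-1` F k).
  split; first by move=> i; exact: (wlength_rescale u r0 (mF i)).1.
  by move=> x /AF [k _ Fk]; exists k.
by apply: eq_eseriesr => k _; rewrite (wlength_rescale u r0 (mF k)).2.
Qed.

Lemma outer_rescale (u r : R) (A : set R) : 0 < r ->
  (outer (rescale u r @^-1` A) = r%:E * outer A)%E.
Proof.
move=> r0; apply/eqP; rewrite eq_le outer_rescale_le//=.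
rewrite -lee_pdivlMl//.
have ri0 : 0 < r^-1 by rewrite invr_gt0.
apply: le_trans (outer_rescale_le (- u / r) _ ri0).
rewrite -comp_preimage (_ : _ \o _ = id) ?preimage_id//.
by apply/funext => x /=; rewrite rescaleVK.
Qed.

Lemma measurable_rescale (u r : R) : 0 < r ->
  measurable_fun setT (rescale u r : lebesgueTypeR R -> lebesgueTypeR R).
Proof.
move=> r0 _ A mA; rewrite setTI.
suff : caratheodory_measurable outer (rescale u r @^-1` A) by [].
have {}mA : caratheodory_measurable outer A by exact: mA.
move=> X.
have [Y ->] : exists Y, X = rescale u r @^-1` Y.
  exists (rescale (- u / r) r^-1 @^-1` X).
  rewrite -comp_preimage (_ : _ \o _ = id) ?preimage_id//.
  by apply/funext => x /=; rewrite rescaleK.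
have E Z := outer_rescale u Z r0.
rewrite preimage_setC -(preimage_setI _ Y A) -(preimage_setI _ Y (~` A)).
rewrite (E Y) (E (Y `&` A)) (E (Y `&` ~` A)).
rewrite -ge0_muleDr ?outer_measure_ge0//; congr (_ * _)%E.
exact: mA.
Qed.

Lemma integral_rescale (u r : R) (h : R -> \bar R) : 0 < r ->
  measurable_fun setT (h : lebesgueTypeR R -> \bar R) -> (forall x, 0 <= h x)%E ->
  (\int[leb]_x h (rescale u r x) = r%:E * \int[leb]_x h x)%E.
Proof.
move=> r0 mh h0.
have mr := measurable_rescale u r0.
rewrite -[in LHS](preimage_setT (rescale u r : lebesgueTypeR R -> lebesgueTypeR R)).
rewrite -(ge0_integral_pushforward mr)//.
rewrite (@eq_measure_integral _ _ _ _ (mscale (NngNum (ltW r0)) leb)).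
  by rewrite ge0_integral_mscale.
by move=> A mA _; exact: outer_rescale.
Qed.

Lemma borel_lebesgue_measurable : measurable_fun setT (idfun : lebesgueTypeR R -> R).
Proof.
move=> _ A mA; rewrite setTI; exact: (@sub_caratheodory _ _ _ (@wlength R idfun) A mA).
Qed.

End OuterMeasure.

(** * Functions with integrable powers *)

Section Gauge.
Context {R : realType}.
Variables (a b : R).
Hypotheses (a0 : 0 < a) (ab : a <= b).

(** This function dominates [|x| ^ p] for all exponents [a <= p <= b] at once,
    is submultiplicative, and is subadditive up to a constant. *)
Definition gauge (x : R) : R := Num.max (`|x| `^ a) (`|x| `^ b).

Let b0 : 0 < b. Proof. exact: lt_le_trans ab. Qed.

Lemma gauge_ge0 x : 0 <= gauge x.
Proof. by rewrite /gauge le_max powR_ge0. Qed.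

Lemma gauge_mono x y : `|x| <= `|y| -> gauge x <= gauge y.
Proof.
move=> xy; rewrite /gauge ge_max !le_max.
have le_powR p : 0 < p -> `|x| `^ p <= `|y| `^ p.
  by move=> p0; apply: (ge0_ler_powR (ltW p0)); rewrite ?nnegrE.
by rewrite (le_powR a)// (le_powR b)// orbT.
Qed.

Lemma powR_le_gauge p x : a <= p <= b -> `|x| `^ p <= gauge x.
Proof.
move=> /andP[ap pb]; rewrite /gauge le_max.
have [->|x0] := eqVneq x 0.
  by rewrite normr0 !powR0 ?lexx// ?gt_eqF// (lt_le_trans a0).
have [x1|x1] := leP `|x| 1.
  by rewrite ger_powR// normr_gt0 x0.
by rewrite orbC ler_powR// ltW.
Qed.

Lemma gaugeM x y : gauge (x * y) <= gauge x * gauge y.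
Proof.
rewrite {1}/gauge normrM !powRM// ge_max; apply/andP; split;
  by apply: ler_pM; rewrite ?powR_ge0// powR_le_gauge// lexx ab.
Qed.

Lemma gaugeD x y : gauge (x + y) <= gauge 2 * (gauge x + gauge y).
Proof.
have key z t : `|z| <= `|t| -> gauge (z + t) <= gauge 2 * gauge t.
  move=> zt; rewrite (le_trans _ (gaugeM _ _))// gauge_mono//.
  rewrite normrM (le_trans (ler_normD _ _))// ger0_norm//; lra.
have [xy|yx] := leP `|x| `|y|.
  by rewrite (le_trans (key _ _ xy))// ler_wpM2l ?gauge_ge0// lerDr gauge_ge0.
rewrite addrC (le_trans (key _ _ (ltW yx)))// ler_wpM2l ?gauge_ge0//.
by rewrite lerDl gauge_ge0.
Qed.

Lemma gauge_le1 t : 0 < t <= 1 -> gauge t = t `^ a.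
Proof.
move=> /andP[t0 t1]; rewrite /gauge gtr0_norm//; apply/max_idPl.
by rewrite ger_powR// t0.
Qed.

Lemma measurable_gauge : measurable_fun setT gauge.
Proof.
have mn := @normr_measurable R setT.
apply: measurable_maxr.
- exact: (measurableT_comp (measurable_powR a) mn).
- exact: (measurableT_comp (measurable_powR b) mn).
Qed.

Lemma gauge_indic (A : set R) x : gauge (\1_A x) = \1_A x.
Proof.
rewrite indicE; case: (_ \in _); rewrite /gauge ?normr1 ?normr0 ?powR1 ?maxxx//.
by rewrite !powR0 ?maxxx// gt_eqF.
Qed.

End Gauge.

Section ModularSpace.
Context {R : realType} d {T : measurableType d} (mu : {measure set T -> \bar R}).
Variables (a b : R).
Hypotheses (a0 : 0 < a) (ab : a <= b).
Implicit Types f g : T -> R.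

Local Notation phi := (gauge a b).

Definition modular f : \bar R := (\int[mu]_x (phi (f x))%:E)%E.

(** The space [F_(a, b)] over an arbitrary measure space. *)
Definition modular_space : set (T -> R) :=
  [set f | measurable_fun setT f /\ (modular f < +oo)%E].

Lemma modular_ge0 f : (0 <= modular f)%E.
Proof. by apply: integral_ge0 => x _; rewrite lee_fin gauge_ge0. Qed.

Lemma measurable_EFin_gauge f :
  measurable_fun setT f -> measurable_fun setT (fun x => (phi (f x))%:E).
Proof.
move=> mf; apply/measurable_EFinP.
exact: (measurableT_comp (measurable_gauge a b) mf).
Qed.

Lemma modularZ c f : measurable_fun setT f ->
  (modular (fun x => c * f x)%R <= (phi c)%:E * modular f)%E.
Proof.
move=> mf.
have mcf : measurable_fun setT (fun x => c * f x) by exact: measurable_funM.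
rewrite /modular -ge0_integralZl_EFin ?gauge_ge0//; last 2 first.
- by move=> x _; rewrite lee_fin gauge_ge0.
- exact: measurable_EFin_gauge.
apply: ge0_le_integral => //.
- by move=> x _; rewrite lee_fin gauge_ge0.
- exact: measurable_EFin_gauge.
- by apply: measurable_funeM; exact: measurable_EFin_gauge.
- by move=> x _; rewrite -EFinM lee_fin gaugeM.
Qed.

Lemma modular_spaceZ c f : modular_space f -> modular_space (fun x => c * f x).
Proof.
move=> [mf If]; split; first exact: measurable_funM.
apply: (le_lt_trans (modularZ c mf)).
by rewrite lte_mul_pinfty// ?lee_fin ?gauge_ge0.
Qed.

Lemma modular_spaceD f g :
  modular_space f -> modular_space g -> modular_space (fun x => f x + g x).
Proof.
move=> [mf If] [mg Ig].
have mfg : measurable_fun setT (fun x => f x + g x) by exact: measurable_funD.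
split; first exact: mfg.
apply: (@le_lt_trans _ _ ((phi 2)%:E * (modular f + modular g))%E); last first.
  by apply: lte_mul_pinfty; [rewrite lee_fin gauge_ge0|by []|exact: (lte_add_pinfty If Ig)].
rewrite /modular -ge0_integralD//; [|by move=> x _; rewrite lee_fin gauge_ge0
  |exact: measurable_EFin_gauge|by move=> x _; rewrite lee_fin gauge_ge0
  |exact: measurable_EFin_gauge].
have mD : measurable_fun setT (fun x => (phi (f x))%:E + (phi (g x))%:E)%E.
  by apply: emeasurable_funD; exact: measurable_EFin_gauge.
rewrite -ge0_integralZl_EFin ?gauge_ge0//; last first.
  by move=> x _; rewrite -EFinD lee_fin addr_ge0 ?gauge_ge0.
apply: ge0_le_integral => //.
- by move=> x _; rewrite lee_fin gauge_ge0.
- exact: measurable_EFin_gauge.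
- exact: measurable_funeM.
- by move=> x _; rewrite -EFinD -EFinM lee_fin gaugeD.
Qed.

Lemma modular_space0 : modular_space (fun=> 0).
Proof.
split; first exact: measurable_cst.
rewrite /modular (_ : (fun _ => _) = cst 0%E) ?integral0 ?ltry//.
apply/funext => x; rewrite /gauge normr0 !powR0 ?maxxx// gt_eqF//.
exact: lt_le_trans ab.
Qed.

Lemma modular_space_sum n (f : 'I_n -> T -> R) (th : 'I_n -> R) :
  (forall j, modular_space (f j)) ->
  modular_space (fun x => \sum_(j < n) th j * f j x).
Proof.
move=> Ff.
suff H (s : seq 'I_n) : modular_space (fun x => \sum_(j <- s) th j * f j x) by exact: H.
elim: s => [|j s ih].
  by under eq_fun do rewrite big_nil; exact: modular_space0.
under eq_fun do rewrite big_cons.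
exact: modular_spaceD (modular_spaceZ (th j) (Ff j)) ih.
Qed.

Lemma measurable_powR_fun f (p : T -> R) :
  measurable_fun setT f -> measurable_fun setT p -> (forall x, 0 < p x) ->
  measurable_fun setT (fun x => `|f x| `^ p x).
Proof.
move=> mf mp p0.
have mn : measurable_fun setT (fun x => `|f x|) by exact: measurableT_comp.
have -> : (fun x => `|f x| `^ p x) =
    (fun x => if `|f x| == 0 then 0 else expR (p x * ln `|f x|)).
  by apply/funext => x; rewrite /powR (gt_eqF (p0 x)).
apply: measurable_fun_ifT => //.
- by apply: measurable_fun_eqr => //; exact: measurable_cst.
- apply: (measurableT_comp (@measurable_expR R)); apply: measurable_funM => //.
  exact: (measurableT_comp (@measurable_ln R)).
Qed.

Lemma modular_le_powR f (p : T -> R) : measurable_fun setT f ->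
  measurable_fun setT p -> (forall x, a <= p x <= b) ->
  (\int[mu]_x (`|f x| `^ p x)%:E <= modular f)%E.
Proof.
move=> mf mp pab.
have p0 x : 0 < p x by have /andP[+ _] := pab x; exact: lt_le_trans.
apply: ge0_le_integral => //.
- by apply/measurable_EFinP; exact: measurable_powR_fun.
- exact: measurable_EFin_gauge.
- by move=> x _; rewrite lee_fin powR_le_gauge.
Qed.

Section WeightedPowers.
Variables (f : T -> R) (c : R).
Hypothesis Ff : modular_space f.

Lemma integral_weighted_powR_le (w p : T -> R) :
  measurable_fun setT w -> measurable_fun setT p -> (forall x, a <= p x <= b) ->
  (forall x, 0 <= w x) -> (forall x, f x != 0 -> w x <= c) -> 0 <= c ->
  (\int[mu]_x (w x * `|f x| `^ p x)%:E <= c%:E * modular f)%E.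
Proof.
move=> mw mp pab w0 wc c0; have [mf If] := Ff.
have p0 x : 0 < p x by have /andP[+ _] := pab x; exact: lt_le_trans.
rewrite /modular -ge0_integralZl_EFin//; last 2 first.
- by move=> x _; rewrite lee_fin gauge_ge0.
- exact: measurable_EFin_gauge.
apply: ge0_le_integral => //.
- by move=> x _; rewrite lee_fin mulr_ge0// powR_ge0.
- apply/measurable_EFinP; apply: measurable_funM => //.
  exact: measurable_powR_fun.
- by apply: measurable_funeM; exact: measurable_EFin_gauge.
move=> x _; rewrite -EFinM lee_fin.
have [fx0|fx0] := eqVneq (f x) 0.
  by rewrite fx0 normr0 powR0 ?gt_eqF// mulr0 mulr_ge0// gauge_ge0.
by rewrite ler_pM ?powR_ge0// ?wc// powR_le_gauge.
Qed.

Lemma Rintegral_weighted_powR_le (w p : T -> R) :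
  measurable_fun setT w -> measurable_fun setT p -> (forall x, a <= p x <= b) ->
  (forall x, 0 <= w x) -> (forall x, f x != 0 -> w x <= c) -> 0 <= c ->
  \int[mu]_x (w x * `|f x| `^ p x) <= c * fine (modular f).
Proof.
move=> mw mp pab w0 wc c0.
have H := integral_weighted_powR_le mw mp pab w0 wc c0.
have fin : modular f \is a fin_num.
  by rewrite ge0_fin_numE; [exact: Ff.2|exact: modular_ge0].
rewrite -lee_fin EFinM [X in (_ <= _ * X)%E]fineK//.
rewrite /Rintegral fineK// ge0_fin_numE.
  by apply: (le_lt_trans H); apply: lte_mul_pinfty; [rewrite lee_fin|by []|exact: Ff.2].
by apply: integral_ge0 => x _; rewrite lee_fin mulr_ge0 ?powR_ge0.
Qed.

(** Dominated convergence with the dominating function [c * gauge f]. The bound on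
    the weights is required on the support of [f] only, since in the application
    it holds on bounded sets. *)
Lemma cvg_integral_weighted_powR (w p : nat -> T -> R) (q : R) :
  (forall n, measurable_fun setT (w n)) -> (forall n, measurable_fun setT (p n)) ->
  (forall n x, a <= p n x <= b) -> a <= q <= b ->
  (forall n x, 0 <= w n x) -> (forall n x, f x != 0 -> w n x <= c) -> 0 <= c ->
  (forall x, f x != 0 -> w n x @[n --> \oo] --> (1 : R)) ->
  (forall x, p n x @[n --> \oo] --> q) ->
  (\int[mu]_x (w n x * `|f x| `^ p n x)) @[n --> \oo] --> \int[mu]_x (`|f x| `^ q).
Proof.
move=> mw mp pab qab w0 wc c0 w1 pq; have [mf If] := Ff.
have p0 n x : 0 < p n x by have /andP[+ _] := pab n x; exact: lt_le_trans.
have q0 : 0 < q by have /andP[+ _] := qab; exact: lt_le_trans.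
have mgf := measurable_EFin_gauge mf.
have mn : measurable_fun setT (fun x => `|f x|) by exact: measurableT_comp.
pose F n x := (w n x * `|f x| `^ p n x)%:E.
pose G x := (c * phi (f x))%:E.
have FG n x : (`|F n x| <= G x)%E.
  rewrite /F /G gee0_abs ?lee_fin ?mulr_ge0 ?powR_ge0//.
  have [fx0|fx0] := eqVneq (f x) 0.
    by rewrite fx0 normr0 powR0 ?gt_eqF// mulr0 mulr_ge0// gauge_ge0.
  by rewrite ler_pM ?powR_ge0// ?wc// powR_le_gauge.
have iG : mu.-integrable setT G.
  have -> : G = (fun x => c%:E * (phi (f x))%:E)%E by [].
  apply/integrableP; split; first exact: measurable_funeM.
  under eq_integral => x _ do rewrite gee0_abs -?EFinM ?lee_fin ?mulr_ge0 ?gauge_ge0//.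
  rewrite /= (_ : (\int[mu]_x _ = c%:E * modular f)%E); last first.
    by rewrite -ge0_integralZl_EFin// => x _; rewrite lee_fin gauge_ge0.
  by apply: lte_mul_pinfty; [rewrite lee_fin|by []|exact: If].
have FL x : F n x @[n --> \oo] --> (`|f x| `^ q)%:E.
  have [fx0|fx0] := eqVneq (f x) 0.
    rewrite /F fx0 normr0 powR0 ?gt_eqF//.
    under eq_fun do rewrite powR0 ?gt_eqF// mulr0.
    exact: cvg_cst.
  apply: cvg_EFin; first exact: nearW.
  rewrite -[X in _ --> X]mul1r; apply: cvgM; first exact: w1.
  have nfx : `|f x| != 0 by rewrite normr_eq0.
  rewrite /powR (negbTE nfx).
  apply: (@continuous_cvg _ _ _ _ _ _ (@expR R)); first exact: continuous_expR.
  by apply: cvgM; [exact: pq|exact: cvg_cst].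
have mF n : measurable_fun setT (F n).
  by apply/measurable_EFinP; apply: measurable_funM => //; exact: measurable_powR_fun.
have mL : measurable_fun setT (fun x => (`|f x| `^ q)%:E).
  by apply/measurable_EFinP; apply: measurable_powR_fun.
have [iL _ cvgI] := dominated_convergence measurableT mF mL
  (aeW mu (fun x _ => FL x)) iG (aeW mu (fun x n _ => FG n x)).
apply: fine_cvg; rewrite fineK ?integrable_fin_num//.
Qed.

End WeightedPowers.

Lemma Rintegral_powR_le (f p : T -> R) :
  modular_space f -> measurable_fun setT p -> (forall x, a <= p x <= b) ->
  \int[mu]_x (`|f x| `^ p x) <= fine (modular f).
Proof.
move=> Ff mp pab.
have := @Rintegral_weighted_powR_le f 1 Ff (fun=> 1) p (measurable_cst _) mp pab
  (fun=> ler01) (fun _ _ => lexx _) ler01.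
by rewrite mul1r; under eq_Rintegral do rewrite mul1r.
Qed.

Lemma Rintegral_scale (h1 h2 : T -> R) (r : R) : 0 <= r ->
  measurable_fun setT h2 -> (forall x, 0 <= h2 x) ->
  (\int[mu]_x (h1 x)%:E = r%:E * \int[mu]_x (h2 x)%:E)%E ->
  \int[mu]_x h1 x = \int[mu]_x (r * h2 x).
Proof.
move=> r0 mh2 h20 E; rewrite /Rintegral E -ge0_integralZl_EFin //; last 2 first.
- by move=> x _; rewrite lee_fin.
- exact/measurable_EFinP.
Qed.

End ModularSpace.

(** * Local behaviour of the exponent function *)

Section LocalWeight.
Context {R : realType}.
Variables (alpha : R -> R) (u : R).
Hypothesis alpha_log : little_o_inv_log alpha.
Hypothesis alphau0 : 0 < alpha u.

(** The hypothesis compares [alpha] at the end points of the interval between [u]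
    and [u + r z]: the left end point is [u] if [z > 0], but [u + r z] if [z < 0],
    whence the need for uniformity in a neighbourhood of [u]. As [|z| <= K], the
    logarithms of [r] and of the length [r |z|] are comparable. *)
Lemma near_exponent_log (K e : R) : 0 < e ->
  \forall r \near 0^'+, forall z, `|z| <= K ->
    `|alpha (u + r * z) - alpha u| * `|ln r| <= e.
Proof.
move=> e0; pose K1 := Num.max K 1.
have K10 : 0 < K1 by rewrite lt_max ltr01 orbT.
pose J : set R := [set` `[u - 1, u + 1]].
have iJ : is_interval J by exact: interval_is_interval.
have bJ : bounded_set J.
  exists (`|u| + 1); split; first exact: num_real.
  move=> M uM x; rewrite /J/= in_itv/= => /andP[x1 x2].
  rewrite (le_trans _ (ltW uM))// ler_norml.
  by have := ler_norm u; have := ler_norm (- u); rewrite normrN; lra.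
have J0 : J !=set0 by exists u; rewrite /J/= in_itv/=; lra.
have /= supJ := alpha_log iJ bJ J0.
have e2 : (0%E < (e / 2)%:E)%E :> bool by rewrite lte_fin divr_gt0.
have [delta /= d0 Hd] := supJ _ (open_ereal_lt' e2).
have modulus s x : 0 < s -> s < delta -> J x ->
    `|alpha (x + s) - alpha x| * `|ln s| <= e / 2.
  move=> s0 sd Jx; rewrite -lee_fin; apply: (le_trans _ (ltW (Hd s _ s0))).
    by apply: ereal_sup_ubound; exists x.
  by rewrite /= sub0r normrN gtr0_norm.
near=> r.
have r0 : 0 < r by near: r; exact: nbhs_right_gt.
have r1 : r < 1 by near: r; exact: nbhs_right_lt.
have rK : r * K1 < 1.
  by rewrite -ltr_pdivlMr//; near: r; apply: nbhs_right_lt; rewrite divr_gt0.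
have rd : r * K1 < delta.
  by rewrite -ltr_pdivlMr//; near: r; apply: nbhs_right_lt; rewrite divr_gt0.
have rK2 : r * (K1 * K1) < 1.
  by rewrite -ltr_pdivlMr ?mulr_gt0//; near: r; apply: nbhs_right_lt;
    rewrite divr_gt0 ?mulr_gt0.
have lnr : ln r < 0 by rewrite ln_lt0// r0.
(* For [s = r |z| <= r K1] one has [s ^ 2 <= r], hence [|ln r| <= 2 |ln s|]. *)
have log_le s : 0 < s -> s <= r * K1 -> `|ln r| <= 2 * `|ln s|.
  move=> s0 sr; rewrite ltr0_norm// ltr0_norm; last first.
    by rewrite ln_lt0// s0 (le_lt_trans sr).
  rewrite -[2]/(1 + 1) mulrDl !mul1r -opprD lerN2 -lnM ?posrE//.
  rewrite ler_ln ?posrE ?mulr_gt0// (@le_trans _ _ ((r * K1) * (r * K1)))//.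
    by rewrite ler_pM// ltW.
  rewrite (_ : _ * _ = r * (r * (K1 * K1))); last by ring.
  by rewrite ler_piMr// ltW.
move=> z zK; have zK1 : `|z| <= K1 by rewrite le_max zK.
have rzK s : s <= K1 -> r * s <= r * K1 by rewrite ler_pM2l.
have J_near s : `|s| <= r * K1 -> J (u + s).
  move=> sK; rewrite /J/= in_itv/= lerD2l lerD2l -ler_norml.
  by rewrite (le_trans sK)// ltW.
have [z0|z0|->] := ltgtP z 0; last first.
- by rewrite mulr0 addr0 subrr normr0 mul0r ltW.
- have s0 : 0 < r * z by rewrite mulr_gt0.
  have sK : r * z <= r * K1 by rewrite rzK// -(gtr0_norm z0).
  have := modulus (r * z) u s0 (le_lt_trans sK rd).
  have Ju : J u by have := J_near 0; rewrite addr0 normr0; apply; rewrite mulr_ge0 ?ltW.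
  move=> /(_ Ju) H; rewrite (le_trans (ler_wpM2l _ (log_le _ s0 sK)))//.
  by move: H; rewrite mulrCA; lra.
- have s0 : 0 < r * - z by rewrite mulr_gt0// oppr_gt0.
  have sK : r * - z <= r * K1 by rewrite rzK// -(ltr0_norm z0).
  have Jx : J (u + r * z) by apply: J_near; rewrite normrM gtr0_norm// rzK.
  have := modulus _ _ s0 (le_lt_trans sK rd) Jx.
  rewrite (_ : u + r * z + r * - z = u); last by ring.
  rewrite distrC => H; rewrite (le_trans (ler_wpM2l _ (log_le _ s0 sK)))//.
  by move: H; rewrite mulrCA; lra.
Unshelve. all: by end_near. Qed.

(** This is [r ^ (1 - alpha (u + r z) / alpha u)], the product of the Jacobian of
    [z |-> u + r z] and of the power of the normalizing factor. *)
Definition local_weight (r z : R) : R :=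
  r * (r `^ (- (alpha u)^-1)) `^ alpha (u + r * z).

Lemma local_weight_ge0 r z : 0 <= r -> 0 <= local_weight r z.
Proof. by move=> r0; rewrite mulr_ge0// powR_ge0. Qed.

Lemma local_weightE r z : 0 < r ->
  local_weight r z = expR (ln r * ((alpha u - alpha (u + r * z)) / alpha u)).
Proof.
move=> r0; rewrite /local_weight -powRrM /powR gt_eqF// -{1}[r]lnK ?posrE//.
by rewrite -expRD; congr expR; field; rewrite lt0r_neq0.
Qed.

Lemma near_local_weight_exponent (K e : R) : 0 < e ->
  \forall r \near 0^'+, forall z, `|z| <= K ->
    `|ln r * ((alpha u - alpha (u + r * z)) / alpha u)| <= e.
Proof.
move=> e0; have := near_exponent_log K (mulr_gt0 e0 alphau0).
apply: filterS => r Hr z /Hr H; rewrite !normrM distrC normfV.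
by rewrite (gtr0_norm alphau0) mulrA ler_pdivrMr// mulrC.
Qed.

Lemma near_local_weight_le (K : R) :
  \forall r \near 0^'+, forall z, `|z| <= K -> local_weight r z <= expR 1.
Proof.
near=> r => z zK; have r0 : 0 < r by near: r; exact: nbhs_right_gt.
rewrite local_weightE// ler_expR (le_trans (ler_norm _))//.
by move: z zK; near: r; apply: near_local_weight_exponent.
Unshelve. all: by end_near. Qed.

Lemma cvg_local_weight z : local_weight r z @[r --> 0^'+] --> (1 : R).
Proof.
have near_eq : {near 0^'+, (fun r => expR (ln r * ((alpha u - alpha (u + r * z)) / alpha u)))
    =1 local_weight ^~ z}.
  by near=> r; rewrite local_weightE//; near: r; exact: nbhs_right_gt.
apply: (cvg_trans (near_eq_cvg near_eq)).
rewrite -expR0; apply: continuous_cvg; first exact: continuous_expR.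
apply/cvgrPdist_le => e e0; near=> r; rewrite sub0r normrN.
have : forall z', `|z'| <= `|z| ->
    `|ln r * ((alpha u - alpha (u + r * z')) / alpha u)| <= e.
  by near: r; exact: near_local_weight_exponent.
by apply.
Unshelve. all: by end_near. Qed.

End LocalWeight.

(** * Multistable integrals *)

Lemma measurable_cst_powR {R : realType} d {T : measurableType d} (k c : R) (p : T -> R) :
  measurable_fun setT p -> measurable_fun setT (fun x => k * c `^ p x).
Proof.
by move=> mp; apply: measurable_funM => //; exact: (measurableT_comp (measurable_powRr c) mp).
Qed.

Section LebesgueSpaces.
Context {R : realType}.
Variables (a b : R).
Hypotheses (a0 : 0 < a) (ab : a <= b).

Lemma measurable_continuous_lebesgue (p : R -> R) :
  continuous p -> measurable_fun setT (p : lebesgueTypeR R -> R).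
Proof.
move=> cp.
exact: (measurableT_comp (continuous_measurable_fun cp) borel_lebesgue_measurable).
Qed.

Lemma Fab_sub_Fvar alpha f : continuous alpha -> (forall x, a <= alpha x <= b) ->
  Fab a b f -> Fvar alpha f.
Proof.
move=> calpha alpha_ab Ff; split; first exact: Ff.1.
have := @modular_le_powR _ _ _ leb a b a0 ab f alpha Ff.1
  (measurable_continuous_lebesgue calpha) alpha_ab.
by move/le_lt_trans; apply; exact: Ff.2.
Qed.

Lemma Fab_rescale u r f : 0 < r -> Fab a b f -> Fab a b (f \o rescale u r).
Proof.
move=> r0 [mf If]; split.
  exact: (measurableT_comp mf (measurable_rescale u r0)).
have g0 x : (0 <= (gauge a b (f x))%:E)%E by rewrite lee_fin gauge_ge0.
rewrite [X in (X < _)%E](integral_rescale u r0 (measurable_EFin_gauge a b mf) g0).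
by apply: lte_mul_pinfty; [rewrite lee_fin ltW|by []|exact: If].
Qed.

Lemma Fab_indic (A : set R) : E0 A -> Fab a b (\1_A : R -> R).
Proof.
move=> [mA Aoo]; split; first exact: measurable_indic.
have -> : (\int[leb]_x (Num.max (`|\1_A x| `^ a) (`|\1_A x| `^ b))%:E =
    \int[leb]_x (\1_A x)%:E)%E.
  by apply: eq_integral => x _; rewrite -[in RHS](gauge_indic a0 ab).
by rewrite integral_indic// setIT.
Qed.

Variables (alpha : R -> R) (u : R).
Hypotheses (calpha : continuous alpha) (alpha_ab : forall x, a <= alpha x <= b).
Hypothesis alpha_log : little_o_inv_log alpha.

Let alpha0 x : 0 < alpha x.
Proof. by have /andP[+ _] := alpha_ab x; exact: lt_le_trans. Qed.

(** Minus the logarithm of the characteristic function of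
    [r ^ (- 1 / alpha u) * scaled_integral I u r f] at [1]. *)
Definition rescaled_exponent (f : R -> R) (r : R) : R :=
  \int[leb]_x (`|r `^ (- (alpha u)^-1) * f (rescale u r x)| `^ alpha x).

Lemma continuous_alpha_affine (r : R) : continuous (fun z : R => alpha (u + r * z)).
Proof.
move=> z; apply: (@continuous_comp _ _ _ (fun z : R => u + r * z) alpha).
  by apply: cvgD; [exact: cvg_cst|apply: cvgM; [exact: cvg_cst|exact: cvg_id]].
exact: calpha.
Qed.

Lemma measurable_local_weight r :
  measurable_fun setT (local_weight alpha u r : lebesgueTypeR R -> R).
Proof.
have mp := measurable_continuous_lebesgue (@continuous_alpha_affine r).
exact: (measurable_cst_powR _ _ mp).
Qed.

Lemma rescaled_exponentE f r : 0 < r -> measurable_fun setT (f : lebesgueTypeR R -> R) ->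
  rescaled_exponent f r =
  \int[leb]_z (local_weight alpha u r z * `|f z| `^ alpha (u + r * z)).
Proof.
move=> r0 mf; pose c := r `^ (- (alpha u)^-1).
pose h z := `|c * f z| `^ alpha (u + r * z).
have mcf : measurable_fun setT ((fun z => c * f z) : lebesgueTypeR R -> R).
  exact: (measurable_funM (measurable_cst _) mf).
have mp := measurable_continuous_lebesgue (@continuous_alpha_affine r).
have mh : measurable_fun setT (h : lebesgueTypeR R -> R).
  exact: (measurable_powR_fun mcf mp (fun z => alpha0 _)).
have mEh : measurable_fun setT ((EFin \o h) : lebesgueTypeR R -> \bar R).
  exact/measurable_EFinP/mh.
have h0 z : 0 <= h z by exact: powR_ge0.
rewrite /rescaled_exponent.
transitivity (\int[leb]_z (r * `|c * f z| `^ alpha (u + r * z))); last first.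
  apply: eq_Rintegral => z _; rewrite /local_weight normrM powRM//.
  by rewrite ger0_norm ?powR_ge0// mulrA.
apply: (Rintegral_scale (ltW r0) mh h0).
rewrite -(integral_rescale u r0 mEh (fun z => h0 z)).
apply: eq_integral => x _; rewrite /h; congr (_ `^ alpha _)%:E.
by rewrite /rescale; field; rewrite gt_eqF.
Qed.

Lemma near_rescaled_exponent_le (K : R) :
  \forall r \near 0^'+, forall f, Fab a b f -> (forall z, K < `|z| -> f z = 0) ->
    rescaled_exponent f r <= expR 1 * fine (modular leb a b f).
Proof.
near=> r => f Ff suppf; have r0 : 0 < r by near: r; exact: nbhs_right_gt.
have wle : forall z, `|z| <= K -> local_weight alpha u r z <= expR 1.
  by near: r; apply: near_local_weight_le.
rewrite rescaled_exponentE//; last exact: Ff.1.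
have mp := measurable_continuous_lebesgue (@continuous_alpha_affine r).
apply: (Rintegral_weighted_powR_le a0 ab Ff (measurable_local_weight r) mp).
- by move=> z; exact: alpha_ab.
- by move=> z; exact/local_weight_ge0/ltW.
- by move=> z fz0; apply: wle; rewrite leNgt; apply: contra fz0 => /suppf ->.
- exact: expR_ge0.
Unshelve. all: by end_near. Qed.

Lemma cvg_rescaled_exponent (K : R) f : Fab a b f -> (forall z, K < `|z| -> f z = 0) ->
  rescaled_exponent f r @[r --> 0^'+] --> \int[leb]_z (`|f z| `^ alpha u).
Proof.
move=> Ff suppf; apply/cvg_at_rightP => v [v0 cv].
(* The weights are bounded only for [r] small, hence the shift by [N]. *)
have [delta /= d0 Hd] := near_local_weight_le alpha_log (alpha0 u) K.
have /cvgrPdist_lt/(_ _ d0) [N _ HN] := cv.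
rewrite -(cvg_shiftn N) /=.
have wle n z : f z != 0 -> local_weight alpha u (v (n + N)%N) z <= expR 1.
  move=> fz0; apply: Hd => //=; first by apply: HN => /=; rewrite leq_addl.
  by rewrite leNgt; apply: contra fz0 => /suppf ->.
under eq_fun do rewrite (rescaled_exponentE (v0 _) Ff.1).
have e1 : 0 <= expR 1 :> R by exact: expR_ge0.
have cvN := cv; rewrite -(cvg_shiftn N) /= in cvN.
pose w n := local_weight alpha u (v (n + N)%N).
pose p n z := alpha (u + v (n + N)%N * z).
have mw n : measurable_fun setT (w n : lebesgueTypeR R -> R).
  exact: measurable_local_weight.
have mp n : measurable_fun setT (p n : lebesgueTypeR R -> R).
  exact: measurable_continuous_lebesgue (@continuous_alpha_affine _).
have w0 n z : 0 <= w n z by exact: local_weight_ge0 (ltW (v0 _)).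
have w1 z : f z != 0 -> w n z @[n --> \oo] --> (1 : R).
  move=> _; have /cvg_at_rightP := cvg_local_weight alpha_log (alpha0 u) z.
  by apply; split => // n; exact: v0.
have pq z : p n z @[n --> \oo] --> alpha u.
  apply: (@continuous_cvg _ _ _ _ _ (fun n => u + v (n + N)%N * z) alpha).
    exact: calpha.
  rewrite -[X in _ --> X]addr0 -[X in _ --> _ + X](mul0r z).
  by apply: cvgD; [exact: cvg_cst|apply: cvgM => //; exact: cvg_cst].
exact: (cvg_integral_weighted_powR a0 ab Ff mw mp (fun n z => alpha_ab _)
  (alpha_ab u) w0 wle e1 w1 pq).
Qed.

End LebesgueSpaces.

(** The characteristic function is real, so the sine transform vanishes. *)
Lemma multistable_char {R : realType} d {T : measurableType d} (P : probability T R)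
    (alpha : R -> R) (I : (R -> R) -> {RV P >-> R}) n (f : 'I_n -> R -> R)
    (th : 'I_n -> R) :
  multistable_integral alpha I -> (forall j, Fvar alpha (f j)) ->
  \int[P]_w cos (\sum_(j < n) th j * I (f j) w) =
    expR (- \int[leb]_x (`|\sum_(j < n) th j * f j x| `^ alpha x)) /\
  \int[P]_w sin (\sum_(j < n) th j * I (f j) w) = 0.
Proof.
move=> HI Ff; have := HI n f th Ff; rewrite /cexpectation unlock => -[Hc Hs].
by split; [exact: Hc|exact: Hs].
Qed.

Lemma compactly_supported_bounded {R : realType} n (f : 'I_n -> R -> R) :
  (forall j, compactly_supported (f j)) ->
  exists K, forall j z, K < `|z| -> f j z = 0.
Proof.
move=> cf.
have /choice[K HK] : forall j, exists K, forall z, K < `|z| -> f j z = 0.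
  move=> j; have [M [_ HM]] := compact_bounded (cf j).
  exists (M + 1) => z Mz; apply: contrapT => /eqP fz.
  have cz : closure [set x | f j x != 0] z by exact: subset_closure.
  have := HM (M + 1); rewrite ltrDl ltr01 => /(_ isT z cz) /=.
  by rewrite leNgt Mz.
exists (\sum_(j < n) `|K j|) => j z Kz; apply: (HK j); apply: le_lt_trans Kz.
by rewrite (bigD1 j)//= (le_trans (ler_norm _))// lerDl sumr_ge0.
Qed.

Lemma sum_row {R : realType} n (th v : 'I_n -> R) :
  \sum_(j < n) th j * (\row_(i < n) v i) ord0 j = \sum_(j < n) th j * v j.
Proof. by apply: eq_bigr => j _; rewrite mxE. Qed.

Section MainResult.
Context {R : realType}.
Variables (a b : R) (alpha : R -> R) (u : R).
Context d {T : measurableType d} (P : probability T R) (I : (R -> R) -> {RV P >-> R}).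
Context d' {T' : measurableType d'} (P' : probability T' R)
  (I_u : (R -> R) -> {RV P' >-> R}).
Hypotheses (a0 : 0 < a) (ab : a <= b).
Hypotheses (calpha : continuous alpha) (alpha_ab : forall x, a <= alpha x <= b).
Hypothesis alpha_log : little_o_inv_log alpha.
Hypothesis HI : multistable_integral alpha I.
Hypothesis HI_u : multistable_integral (fun=> alpha u) I_u.

Lemma scaled_integral_char (n : nat) (f : 'I_n -> R -> R) (th : 'I_n -> R) (r : R) :
  0 < r -> (forall j, Fab a b (f j)) ->
  \int[P]_w cos (\sum_(j < n) th j *
      (r `^ (- (alpha u)^-1) * scaled_integral I u r (f j) w)) =
    expR (- rescaled_exponent alpha u (fun x => \sum_(j < n) th j * f j x) r) /\
  \int[P]_w sin (\sum_(j < n) th j *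
      (r `^ (- (alpha u)^-1) * scaled_integral I u r (f j) w)) = 0.
Proof.
move=> r0 Ff; set c := r `^ _.
have Fv j : Fvar alpha (f j \o rescale u r).
  exact: (Fab_sub_Fvar a0 ab calpha alpha_ab (Fab_rescale u r0 (Ff j))).
have [Hc Hs] := multistable_char (fun j => th j * c) HI Fv.
have E w : \sum_(j < n) th j * (c * scaled_integral I u r (f j) w) =
    \sum_(j < n) th j * c * I (f j \o rescale u r) w.
  by apply: eq_bigr => j _; rewrite mulrA.
split; under eq_Rintegral do rewrite E; last exact: Hs.
rewrite Hc; congr (expR (- _)).
apply: eq_Rintegral => x _; congr (`|_| `^ _).
by rewrite mulr_sumr; apply: eq_bigr => j _; rewrite mulrCA mulrA.
Qed.

Lemma limit_integral_char (n : nat) (f : 'I_n -> R -> R) (th : 'I_n -> R) :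
  (forall j, Fab a b (f j)) ->
  \int[P']_w cos (\sum_(j < n) th j * I_u (f j) w) =
    expR (- \int[leb]_x (`|\sum_(j < n) th j * f j x| `^ alpha u)) /\
  \int[P']_w sin (\sum_(j < n) th j * I_u (f j) w) = 0.
Proof.
move=> Ff; apply: (multistable_char th HI_u) => j.
exact: (Fab_sub_Fvar a0 ab (fun=> cvg_cst _) (fun=> alpha_ab u) (Ff j)).
Qed.

Lemma gauge_modular_le (t : R) (f : R -> R) : 0 < t <= 1 -> Fab a b f ->
  fine (modular leb a b (fun x => t * f x)) <= t `^ a * fine (modular leb a b f).
Proof.
move=> t01 Ff.
have fin g : Fab a b g -> modular leb a b g \is a fin_num.
  by move=> Fg; rewrite ge0_fin_numE; [exact: Fg.2|exact: modular_ge0].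
rewrite -lee_fin EFinM.
rewrite [X in (X <= _)%E]fineK; last exact/fin/modular_spaceZ.
rewrite [X in (_ <= _ * X)%E]fineK; last exact: fin.
by rewrite -(gauge_le1 ab t01); exact: (modularZ _ a0 ab t Ff.1).
Qed.

(** The bound required for tightness, from [1 - exp (- x) <= x]. *)
Lemma limit_integral_tail (t : R) (f : R -> R) : 0 < t <= 1 -> Fab a b f ->
  1 - \int[P']_w cos (t * I_u f w) <= t `^ a * fine (modular leb a b f).
Proof.
move=> t01 Ff.
have [Hc _] := @limit_integral_char 1 (fun=> f) (fun=> t) (fun=> Ff).
move: Hc; under [X in X = _ -> _]eq_Rintegral do rewrite big_ord1.
move=> ->; rewrite lerBlDr -lerBlDl.
apply: (le_trans _ (expR_ge1Dx _)); rewrite lerD2l lerN2.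
apply: (le_trans _ (gauge_modular_le t01 Ff)).
under eq_Rintegral do rewrite big_ord1.
exact: (Rintegral_powR_le a0 ab (modular_spaceZ a0 ab t Ff) (measurable_cst _)
  (fun=> alpha_ab u)).
Qed.

(** The bound on the exponents of the functions [t * f] is a hypothesis, so that
    the same small [r] serves for all [t]. *)
Lemma scaled_integral_tail (t r K : R) (f : R -> R) : 0 < t <= 1 -> 0 < r ->
  (forall g, Fab a b g -> (forall z, K < `|z| -> g z = 0) ->
    rescaled_exponent alpha u g r <= expR 1 * fine (modular leb a b g)) ->
  Fab a b f -> (forall z, K < `|z| -> f z = 0) ->
  1 - \int[P]_w cos (t * (r `^ (- (alpha u)^-1) * scaled_integral I u r f w)) <=
    expR 1 * (t `^ a * fine (modular leb a b f)).
Proof.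
move=> t01 r0 Hr Ff suppf.
have [Hc _] := @scaled_integral_char 1 (fun=> f) (fun=> t) r r0 (fun=> Ff).
move: Hc; under [X in X = _ -> _]eq_Rintegral do rewrite big_ord1.
move=> ->; rewrite lerBlDr -lerBlDl.
apply: (le_trans _ (expR_ge1Dx _)); rewrite lerD2l lerN2.
apply: (@le_trans _ _ (expR 1 * fine (modular leb a b (fun x => t * f x)))); last first.
  by rewrite ler_wpM2l ?expR_ge0// gauge_modular_le.
rewrite (_ : (fun x => \sum_(j < 1) t * f x) = (fun x => t * f x)); last first.
  by apply/funext => x; rewrite big_ord1.
apply: Hr; first exact: (modular_spaceZ a0 ab t Ff).
by move=> z /suppf ->; rewrite mulr0.
Qed.

Lemma scaled_integral_cvg (n : nat) (f : 'I_n -> R -> R) :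
  (forall j, Fab a b (f j)) -> (forall j, compactly_supported (f j)) ->
  cvg_in_distribution P
    (fun r w => \row_(j < n) (r `^ (- (alpha u)^-1) * scaled_integral I u r (f j) w))
    (0^'+)
    P' (fun w => \row_(j < n) I_u (f j) w).
Proof.
move=> Ff /compactly_supported_bounded[K HK].
have e1 : 0 <= expR 1 :> R by exact: expR_ge0.
have mod0 g : 0 <= fine (modular leb a b g) by exact/fine_ge0/modular_ge0.
apply: cvg_in_distribution_char.
- move=> r j; under eq_fun do rewrite mxE; exact: measurable_funM.
- by move=> j; under eq_fun do rewrite mxE; exact: measurable_funPT.
- move=> th; under [X in _ --> X]eq_Rintegral do under eq_bigr do rewrite mxE.
  rewrite (limit_integral_char th Ff).1.
  pose F x := \sum_(j < n) th j * f j x.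
  have FF : Fab a b F by exact: (modular_space_sum a0 ab th Ff).
  have suppF z : K < `|z| -> F z = 0.
    by move=> Kz; rewrite /F big1// => j _; rewrite HK ?mulr0.
  have near_eq : {near 0^'+, (fun r => expR (- rescaled_exponent alpha u F r)) =1
      (fun r => \int[P]_w cos (\sum_(j < n) th j *
        (\row_j (r `^ (- (alpha u)^-1) * scaled_integral I u r (f j) w)) ord0 j))}.
    near=> r; have r0 : 0 < r by near: r; exact: nbhs_right_gt.
    rewrite -(scaled_integral_char th r0 Ff).1.
    by apply: eq_Rintegral => w _; rewrite sum_row.
  apply: (cvg_trans (near_eq_cvg near_eq)).
  apply: continuous_cvg; first exact: continuous_expR.
  by apply: cvgN; exact: (cvg_rescaled_exponent a0 ab calpha alpha_ab alpha_log FF suppF).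
- move=> th; under [X in _ --> X]eq_Rintegral do under eq_bigr do rewrite mxE.
  rewrite (limit_integral_char th Ff).2.
  have near_eq : {near 0^'+, (fun=> 0 : R) =1
      (fun r => \int[P]_w sin (\sum_(j < n) th j *
        (\row_j (r `^ (- (alpha u)^-1) * scaled_integral I u r (f j) w)) ord0 j))}.
    near=> r; have r0 : 0 < r by near: r; exact: nbhs_right_gt.
    rewrite -[LHS](scaled_integral_char th r0 Ff).2.
    by apply: eq_Rintegral => w _; rewrite sum_row.
  by apply: (cvg_trans (near_eq_cvg near_eq)); exact: cvg_cst.
- move=> e e0.
  pose C := expR 1 * \sum_(j < n) fine (modular leb a b (f j)).
  have C0 : 0 <= C by rewrite mulr_ge0// sumr_ge0.
  have [L L0 HL] := tail_uniform a0 C0 e0.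
  have le_sum j : fine (modular leb a b (f j)) <= \sum_(i < n) fine (modular leb a b (f i)).
    by rewrite (bigD1 j)//= lerDl sumr_ge0.
  have e1ge1 : 1 <= expR 1 :> R by rewrite -expR0 ler_expR.
  have bound j t : expR 1 * (t `^ a * fine (modular leb a b (f j))) <= C * t `^ a.
    rewrite /C mulrCA mulrC ler_wpM2r ?powR_ge0// ler_wpM2l//.
  exists L => //; split.
    move=> j; apply: HL; first by under eq_fun do rewrite mxE; exact: measurable_funPT.
    move=> t t01; under eq_Rintegral do rewrite mxE.
    apply: (le_trans (limit_integral_tail t01 (Ff j))).
    by apply: le_trans (bound j t); rewrite ler_peMl// mulr_ge0// powR_ge0.
  near=> r; have r0 : 0 < r by near: r; exact: nbhs_right_gt.
  have Hr : forall g, Fab a b g -> (forall z, K < `|z| -> g z = 0) ->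
      rescaled_exponent alpha u g r <= expR 1 * fine (modular leb a b g).
    by near: r; exact: near_rescaled_exponent_le.
  move=> j; apply: HL; first by under eq_fun do rewrite mxE; exact: measurable_funM.
  move=> t t01; under eq_Rintegral do rewrite mxE.
  exact: le_trans (scaled_integral_tail t01 r0 Hr (Ff j) (HK j)) (bound j t).
Unshelve. all: by end_near. Qed.

End MainResult.

Theorem theorem2p7 (R : realType) (a b : R) (alpha : R -> R) (u : R)
    (d : measure_display) (T : measurableType d) (P : probability T R)
    (I : (R -> R) -> {RV P >-> R})
    (d' : measure_display) (T' : measurableType d') (P' : probability T' R)
    (I_u : (R -> R) -> {RV P' >-> R})
    (a_gt0 : 0 < a) (a_le_b : a <= b) (b_le2 : b <= 2)
    (alpha_ab : forall x, a <= alpha x <= b)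
    (alpha_cont : continuous alpha)
    (alpha_log : little_o_inv_log alpha)
    (HI : multistable_integral alpha I)
    (HI_u : multistable_integral (fun _ => alpha u) I_u) :
  (forall (n : nat) (f : 'I_n -> R -> R),
     (forall j, Fab a b (f j)) ->
     (forall j, compactly_supported (f j)) ->
     cvg_in_distribution P
       (fun r w => \row_(j < n)
          (r `^ (- (alpha u)^-1) * scaled_integral I u r (f j) w))
       (0^'+)
       P' (fun w => \row_(j < n) I_u (f j) w))
  /\
  (forall (n : nat) (A : 'I_n -> set R),
     (forall j, E0 (A j)) ->
     (forall j, bounded_set (A j)) ->
     cvg_in_distribution P
       (fun r w => \row_(j < n)
          (r `^ (- (alpha u)^-1) * scaled_measure I u r (A j) w))
       (0^'+)
       P' (fun w => \row_(j < n) random_measure I_u (A j) w)).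
Proof.
have integrals := scaled_integral_cvg a_gt0 a_le_b alpha_cont alpha_ab alpha_log HI HI_u.
split; first exact: integrals.
move=> n A A0 Abnd.
apply: (integrals n (fun j => \1_(A j))) => j; first exact: Fab_indic.
have supp : [set x | (\1_(A j) x : R) != 0] = A j.
  by apply/seteqP; split => x /=; rewrite indicE pnatr_eq0 eqb0 negbK inE.
rewrite /compactly_supported supp.
have [M [_ HM]] := Abnd j.
have AM : A j `<=` `[- (`|M| + 1), `|M| + 1].
  move=> x Ax; rewrite /= in_itv/= -ler_norml; apply: HM => //.
  by rewrite ltr_pwDr// ler_norm.
apply: (subclosed_compact (@closed_closure _ _)
  (@segment_compact R (- (`|M| + 1)) (`|M| + 1))).
apply: subset_trans (closureS AM) _.
by rewrite -((closure_id _).1 (interval_closed _ _)).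
Qed.
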